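(* Let $\alpha\in FT_1$. Let $N$ be an integer and suppose that $\mu(n\alpha)=\alpha$ for all integers $n\ge N$ with $n\geq 1$. Then $\alpha$ is Cauchy or Dirac.
   Context: $FT_1$ is the set of probabilities $\alpha$ on $\mathbb{R}$ with $\int\log(1+|x|)\alpha(dx)<\infty$. For $\alpha\in FT_1$ and $t>0$, let $B_1,Y_1,B_2,Y_2,\ldots$ be independent with $B_k\sim\alpha$ and $Y_k\sim\beta(1,t)$ (density $t(1-y)^{t-1}$ on $(0,1)$), and put $W_1=Y_1$, $W_k=Y_k(1-Y_{k-1})\cdots(1-Y_1)$ for $k>1$. The series $X_t=\sum_{k\ge1}W_kB_k$ converges absolutely almost surely, and $\mu(t\alpha)$ denotes its distribution (it is the law of $\int x\,P_t(dx)$ for a Dirichlet random probability $P_t=\sum_k W_k\delta_{B_k}\sim\mathcal{D}(t\alpha)$). ''Cauchy'' means $\alpha(dx)=\frac1\pi\frac{b\,dx}{(x-a)^2+b^2}$ for some $a\in\mathbb{R}$, $b>0$; ''Dirac'' means $\alpha=\delta_a$ for some $a\in\mathbb{R}$. *)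

(* Defs.v *)
(* MathComp-Analysis, over an arbitrary [R : realType] *)
From HB Require Import structures.
From mathcomp Require Import all_boot all_order all_algebra finmap.
From mathcomp Require Import all_classical all_reals all_analysis.

Set Implicit Arguments.
Unset Strict Implicit.
Unset Printing Implicit Defensive.

Import Order.TTheory GRing.Theory Num.Theory.
Import numFieldNormedType.Exports.

Local Open Scope classical_set_scope.
Local Open Scope ring_scope.

Definition same_law (R : realType) (m1 m2 : set R -> \bar R) : Prop :=
  forall A : set R, measurable A -> m1 A = m2 A.

Definition has_density (R : realType) (m : set R -> \bar R) (f : R -> R)
    : Prop :=
  forall A : set R, measurable A ->
    m A = (\int[lebesgue_measure]_(x in A) (f x)%:E)%E.

Definition FT1 (R : realType) (alpha : probability R R) : Prop :=
  (\int[alpha]_x (ln (1 + `|x|))%:E < +oo)%E.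

(* [beta_prob] only covers integer parameters, hence the explicit density for
   a real [t]. *)
Definition beta1_pdf (R : realType) (t : R) : R -> R :=
  (fun y => t * (1 - y) `^ (t - 1)) \_ `]0, 1[.

Definition mutually_independent (d : measure_display) (T : measurableType d)
    (R : realType) (P : probability T R) (I : choiceType)
    (X : I -> {RV P >-> R}) : Prop :=
  forall (J : {fset I}) (A : I -> set R), (forall i, measurable (A i)) ->
    P (\bigcap_(i in [set` J]) (X i @^-1` A i)) =
    (\prod_(i <- J) P (X i @^-1` A i))%E.

(* Indices start at 0: [stick_weight Y k] is the weight W_(k+1). *)
Definition stick_weight (R : realType) (T : Type) (Y : nat -> T -> R)
    (k : nat) (w : T) : R :=
  Y k w * \prod_(j < k) (1 - Y j w).

(* [is_mu t alpha nu] says that nu is mu(t alpha): nu is the law of the almost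
   sure sum X of the series, for some realization of the independent variables
   B_k, Y_k. The law of X does not depend on the realization. *)
Definition is_mu (R : realType) (t : R) (alpha nu : probability R R) : Prop :=
  exists (d : measure_display) (T : measurableType d) (P : probability T R)
         (B Y : nat -> {RV P >-> R}) (X : {RV P >-> R}),
    [/\ mutually_independent
          (fun i : nat + nat => match i with inl k => B k | inr k => Y k end),
        (forall k, same_law (distribution P (B k)) alpha),
        (forall k, has_density (distribution P (Y k)) (beta1_pdf t)),
        {ae P, forall w, series (fun k => stick_weight Y k w * B k w) n
                           @[n --> \oo] --> X w}
      & same_law (distribution P X) nu].

Definition cauchy_pdf (R : realType) (a b x : R) : R :=
  pi^-1 * (b / ((x - a) ^+ 2 + b ^+ 2)).

Definition is_cauchy (R : realType) (alpha : probability R R) : Prop :=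
  exists a b : R, 0 < b /\ has_density alpha (cauchy_pdf a b).

Definition is_dirac (R : realType) (alpha : probability R R) : Prop :=
  exists a : R, same_law alpha \d_a.

(* Main.v *)
Require Import Defs.
From HB Require Import structures.
From mathcomp Require Import all_boot all_order all_algebra finmap.
From mathcomp Require Import all_classical all_reals all_analysis.
From mathcomp Require Import measurable_realfun ring lra.

(* By the stick-breaking construction, mu(t alpha) = alpha makes alpha the law of
   Y B + (1 - Y) B' with Y ~ beta(1, t) and B, B' ~ alpha independent. As t runs
   over the large integers, the polynomial moments of
   y |-> E phi(y B + (1 - y) B') - E phi(B) against the densities n (1 - y)^(n-1)
   vanish, so this continuous function vanishes on [0, 1]: every convex
   combination y B + (1 - y) B' has law alpha. Let f(z) = E 1 / (z - B) on the
   upper half-plane. Averaging over y Feynman's identity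
     1 / ((z - b) (w - b')) =
       int_0^1 dy / (y (z - b) + (1 - y) (w - b'))^2
   once for (B, B') and once for (B, B) gives f(z) f(w) = E 1 / ((z - B) (w - B)),
   which is (f(w) - f(z)) / (z - w). Thus 1 / f(z) - z is constant and
   f(z) = 1 / (z - a + i b) with b >= 0. If b = 0, then Im f forces alpha to be the
   Dirac mass at a; otherwise Stieltjes inversion yields the Cauchy density. *)

Set Implicit Arguments.
Unset Strict Implicit.
Unset Printing Implicit Defensive.

Import Order.TTheory GRing.Theory Num.Theory.
Import numFieldNormedType.Exports.

Local Open Scope classical_set_scope.
Local Open Scope ring_scope.

(** * Integrals of bounded functions *)

Section bounded_integrals.
Context {R : realType}.

(** Independence in [is_mu] is a product formula for finitely many coordinates, while the
    fixed-point equation separates the first pair from an infinite tail. The recursion is therefore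
    proved in law for truncated sums, and only integrals of bounded continuous functions are passed
    to the limit. The equation for t = n controls the moment of order n - 1 alone, and only for
    large n; a power of 1 - y absorbed into the function turns this into the vanishing of all its
    moments. Since the invariance holds for each fixed y, the test function may itself depend on y.
    Feynman's kernel 1 / (z_y - x)^2, with z_y = y z + (1 - y) w, is chosen for this: at x = y B +
    (1 - y) B' the base of its denominator is y (z - B) + (1 - y) (w - B'), and for B' = B the
    argument x is B whatever y is. Complex identities are carried as pairs of real ones, with 1 / (p
    + i q) = [re_inv p q] - i [im_inv p q]. *)

Lemma bounded_integrable d (T : measurableType d) (P : probability T R)
    (f : T -> R) (M : R) :
  measurable_fun setT f -> (forall x, `|f x| <= M) ->
  P.-integrable setT (EFin \o f).
Proof.
move=> mf fM; apply: measurable_bounded_integrable => //.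
  by rewrite -ge0_fin_numE// fin_num_measure.
exists M; split; first by rewrite num_real.
by move=> x xM t _; exact: (le_trans (fM t) (ltW xM)).
Qed.

Lemma Rintegral_bounded d (T : measurableType d) (P : probability T R)
    (f : T -> R) (M : R) :
  measurable_fun setT f -> (forall x, `|f x| <= M) ->
  `|\int[P]_x f x| <= M.
Proof.
move=> mf fM; have intf := bounded_integrable P mf fM.
apply: (le_trans (le_normr_Rintegral _ _)) => //.
rewrite (_ : M = \int[P]_(x in setT) M); last first.
  by rewrite Rintegral_cst// [X in fine X]probability_setT/= mulr1.
apply: le_Rintegral => //; first exact: integrable_norm.
apply: (@bounded_integrable _ _ P (cst M) `|M|) => //.
Qed.

Lemma EFin_Rintegral d (T : measurableType d) (mu : {measure set T -> \bar R})
    (D : set T) (f : T -> R) : measurable D ->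
  mu.-integrable D (EFin \o f) ->
  (\int[mu]_(x in D) f x)%:E = (\int[mu]_(x in D) (f x)%:E)%E.
Proof. by move=> mD intf; rewrite /Rintegral fineK//; exact: integrable_fin_num. Qed.

Lemma Rintegral_cvg_bounded d (T : measurableType d) (P : probability T R)
    (f_ : nat -> T -> R) (f : T -> R) (M : R) :
  (forall n, measurable_fun setT (f_ n)) -> measurable_fun setT f ->
  {ae P, forall x, f_ n x @[n --> \oo] --> f x} ->
  (forall n x, `|f_ n x| <= M) ->
  \int[P]_x f_ n x @[n --> \oo] --> \int[P]_x f x.
Proof.
move=> mf_ mf f_f fM.
have iM : P.-integrable setT (EFin \o (fun=> M)).
  by apply: (@bounded_integrable _ _ P _ `|M|).
have [] := @dominated_convergence _ _ _ P setT measurableT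
  (fun n => EFin \o f_ n) (EFin \o f) (EFin \o (fun=> M)).
- by move=> n; exact/measurable_EFinP.
- exact/measurable_EFinP.
- by apply: filterS f_f => x fx _; apply: cvg_EFin => //; exact: nearW.
- exact: iM.
- by apply: aeW => x n _; rewrite lee_fin.
- move=> intf _ h.
  by apply: fine_cvg; rewrite fineK//; exact: integrable_fin_num.
Qed.

Section fubini.
Context d1 d2 (T1 : measurableType d1) (T2 : measurableType d2).
Variables (P1 : probability T1 R) (P2 : probability T2 R).
Variables (f : T1 * T2 -> R) (M : R).
Hypotheses (mf : measurable_fun setT f) (fM : forall x, `|f x| <= M).

Let intf : (P1 \x P2)%E.-integrable setT (EFin \o f).
Proof. exact: (@bounded_integrable _ _ (P1 \x P2)%E). Qed.

Lemma measurable_Rintegral_fst :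
  measurable_fun setT (fun x => \int[P2]_y f (x, y)).
Proof.
apply: measurableT_comp => //.
exact: (@measurable_fubini_F _ _ _ _ _ P1 P2 (EFin \o f)).
Qed.

Lemma Rintegral_prod12 :
  \int[P1]_x \int[P2]_y f (x, y) = \int[(P1 \x P2)%E]_z f z.
Proof.
rewrite /Rintegral; congr fine.
rewrite -(integral12_prod_meas1 intf); apply: eq_integral => x _.
rewrite -[LHS]/((\int[P2]_y f (x, y))%:E) EFin_Rintegral//.
apply: (@bounded_integrable _ _ P2 _ M) => //.
exact: measurableT_comp.
Qed.

Lemma Rintegral_prod21 :
  \int[P2]_y \int[P1]_x f (x, y) = \int[(P1 \x P2)%E]_z f z.
Proof.
rewrite /Rintegral; congr fine.
rewrite -(integral21_prod_meas1 intf); apply: eq_integral => x _.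
rewrite -[LHS]/((\int[P1]_y f (y, x))%:E) EFin_Rintegral//.
apply: (@bounded_integrable _ _ P1 _ M) => //.
exact: measurableT_comp.
Qed.

End fubini.

End bounded_integrals.

(** * The stick-breaking fixed point *)

Section joint_laws.
Context d d1 d2 (T : measurableType d) (T1 : measurableType d1)
  (T2 : measurableType d2) (R : realType).
Variables (P : probability T R) (P1 : probability T1 R) (P2 : probability T2 R).
Local Open Scope ereal_scope.

(** Conditionally on [F], the law of (U, W) agrees with the product on rectangles, hence everywhere
    by uniqueness of product measures. The event [F] is kept so that it can record the past, or a
    constraint on the future. *)
Lemma joint_law_unique (F : set T) (U : T -> T1) (W : T -> T2) :
  measurable F -> measurable_fun setT U -> measurable_fun setT W ->
  (forall A C, measurable A -> measurable C ->
    P (F `&` (U @^-1` A `&` W @^-1` C)) = P F * (P1 A * P2 C)) ->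
  forall D, measurable D ->
    P (F `&` (fun w => (U w, W w)) @^-1` D) = P F * (P1 \x P2) D.
Proof.
move=> mF mU mW FE D mD.
have mUW : measurable_fun setT (fun w => (U w, W w)) by exact: measurable_fun_pair.
have mV : measurable ((fun w => (U w, W w)) @^-1` D).
  by rewrite -[X in measurable X]setTI; exact: mUW.
(* The conditional law needs division by [P F]; in the null case both sides vanish. *)
have [PF0|PF0] := eqVneq (P F) 0.
  rewrite PF0 mul0e; apply/eqP; rewrite eq_le measure_ge0 andbT -PF0.
  by rewrite le_measure ?inE//; exact: measurableI.
have PFfin : P F \is a fin_num by rewrite fin_num_measure.
have c0 : (0 <= (fine (P F))^-1)%R by rewrite invr_ge0 fine_ge0.
have cK : (fine (P F))^-1%:E * P F = 1.
  by rewrite -[X in _ * X](fineK PFfin) -EFinM mulVf// fine_eq0.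
pose m := mscale (NngNum c0) (pushforward (mrestr P mF) (fun w => (U w, W w))).
have mP : m mUW D = (P1 \x P2) D.
  apply/esym; apply: (@product_measure_unique _ _ _ _ _ P1 P2 (m mUW)) => // A C mA mC.
  rewrite /m/= /mscale/= /pushforward/= /mrestr/= setIC.
  transitivity ((fine (P F))^-1%:E * P (F `&` (U @^-1` A `&` W @^-1` C))) => //.
  by rewrite FE// muleA cK mul1e.
rewrite -mP /m/= /mscale/= /pushforward/= /mrestr/= setIC muleA.
by rewrite [P F * _]muleC cK mul1e.
Qed.

End joint_laws.

(** * Independence of past and future sticks *)

Section stick_independence.
Context d (T : measurableType d) (R : realType) (P : probability T R).
Variables (B Y : nat -> {RV P >-> R}) (beta alpha : probability R R).
Hypothesis indepBY : mutually_independent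
  (fun i : nat + nat => match i with inl k => B k | inr k => Y k end).
Hypothesis lawB : forall k A, measurable A -> P (B k @^-1` A) = alpha A.
Hypothesis lawY : forall k A, measurable A -> P (Y k @^-1` A) = beta A.
Local Open Scope ereal_scope.

Let mpre (X : {RV P >-> R}) A : measurable A -> measurable (X @^-1` A).
Proof. by move=> mA; exact: measurable_funPTI. Qed.

(** Cylinders on the consecutive pairs (Y, B) from index [k] on: the test events for the future.
    First components constrain Y, second ones B. *)
Fixpoint block k (l : seq (set R * set R)) : set T :=
  if l is AC :: l' then
    (Y k @^-1` AC.1 `&` B k @^-1` AC.2) `&` block k.+1 l'
  else setT.

Definition measurable_block (l : seq (set R * set R)) :=
  forall AC, AC \in l -> measurable AC.1 /\ measurable AC.2.

Lemma measurable_block_cons A C l : measurable A -> measurable C ->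
  measurable_block l -> measurable_block ((A, C) :: l).
Proof. by move=> mA mC ml AC; rewrite inE => /predU1P[->//|/ml]. Qed.

Lemma measurable_block_tail AC l : measurable_block (AC :: l) ->
  [/\ measurable AC.1, measurable AC.2 & measurable_block l].
Proof.
move=> ml; have [m1 m2] := ml AC (mem_head _ _); split => // x xl.
by apply: ml; rewrite inE xl orbT.
Qed.

Lemma block_measurable k l : measurable_block l -> measurable (block k l).
Proof.
elim: l k => [|AC l IH] k; first by move=> _; exact: measurableT.
move=> /measurable_block_tail[mA mC ml] /=.
by apply: measurableI; [apply: measurableI; exact: mpre|exact: IH].
Qed.

Definition block_weight (l : seq (set R * set R)) :=
  \prod_(AC <- l) (beta AC.1 * alpha AC.2).

Let X (i : nat + nat) := match i with inl k => B k | inr k => Y k end.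

Let index (i : nat + nat) := match i with inl k => k | inr k => k end.

Lemma probability_block k l : measurable_block l ->
  P (block k l) = block_weight l.
Proof.
move=> ml.
(* The induction moves the head pair of the list into [J], until the nested intersection has become
   a single one over a finite set, to which [indepBY] applies. Keeping [J] below [k] makes the
   indices [inl k] and [inr k] fresh. *)
suff : forall (J : {fset nat + nat}) (A : nat + nat -> set R),
    (forall i, measurable (A i)) -> (forall i, i \in J -> (index i < k)%N) ->
    P (\bigcap_(i in [set` J]) (X i @^-1` A i) `&` block k l) =
    (\prod_(i <- J) P (X i @^-1` A i)) * block_weight l.
  move=> /(_ fset0 (fun=> setT)); rewrite set_fset0 bigcap_set0 setTI => ->//.
  by rewrite big_seq_fset0 mul1e.
elim: l k ml => [|[A C] l IH] k ml J S mS Jk.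
  by rewrite /= setIT /block_weight big_nil mule1 -indepBY.
have [mA mC {}ml] := measurable_block_tail ml.
pose S' i := match i with
  | inl j => if j == k then C else S (inl j)
  | inr j => if j == k then A else S (inr j) end.
have SS' i : i \in J -> S' i = S i.
  by case: i => j /Jk/= jk; rewrite ifF// ltn_eqF.
have mS' i : measurable (S' i) by case: i => j /=; case: ifPn.
have rJ : inr k \notin J by apply/negP => /Jk; rewrite /= ltnn.
have lJ : inl k \notin (inr k |` J)%fset.
  by rewrite !inE/=; apply/negP => /Jk; rewrite /= ltnn.
have := IH k.+1 ml (inl k |` (inr k |` J))%fset S' mS'.
rewrite !bigcap_fsetU1 !big_fsetU1//= eqxx lawB// lawY//.
rewrite (eq_bigcapr (G := fun i => X i @^-1` S i)); last first.
  by move=> i /= iJ; rewrite SS'.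
rewrite big_seq_cond (eq_bigr (fun i => P (X i @^-1` S i))); last first.
  by move=> i /andP[iJ _]; rewrite SS'.
rewrite -big_seq_cond /block_weight big_cons/= => H.
transitivity (alpha C * (beta A * (\prod_(i <- J) P (X i @^-1` S i))) *
    (\prod_(AC <- l) (beta AC.1 * alpha AC.2))).
  rewrite -H; last first.
    by move=> i; rewrite !inE => /orP[/eqP->//|/orP[/eqP->//|/Jk/leqW]].
  by congr (P _); apply/seteqP; split => w /=; tauto.
by rewrite !muleA; congr (_ * _); rewrite muleC [alpha C * _]muleC muleA.
Qed.

(** Replaces membership in the sigma-algebra of the pairs before [k]: only the product formula
    against future cylinders is retained, and [indep_of_futureS] shows that it propagates. *)
Definition indep_of_future k (E : set T) := measurable E /\
  forall l, measurable_block l -> P (E `&` block k l) = P E * block_weight l.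

Lemma indep_of_futureT : indep_of_future 0 setT.
Proof.
split=> // l ml; rewrite setTI probability_block//.
by rewrite probability_setT mul1e.
Qed.

(** Prefixing a cylinder with a rectangle for the pair [k] gives the product formula on rectangles;
    [joint_law_unique], applied with the remaining cylinder inside the conditioning event, extends
    it to every [D]. *)
Lemma indep_of_futureS k E D : measurable D -> indep_of_future k E ->
  P (E `&` (fun w => (Y k w, B k w)) @^-1` D) = P E * (beta \x alpha) D /\
  indep_of_future k.+1 (E `&` (fun w => (Y k w, B k w)) @^-1` D).
Proof.
move=> mD [mE PE].
have mYB : measurable_fun setT (fun w => (Y k w, B k w)).
  by apply: measurable_fun_pair; exact: measurable_funPT.
have key l : measurable_block l ->
    P (E `&` block k.+1 l `&` (fun w => (Y k w, B k w)) @^-1` D) =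
    P (E `&` block k.+1 l) * (beta \x alpha) D.
  move=> ml; apply: joint_law_unique => //.
  - by apply: measurableI => //; exact: block_measurable.
  - move=> A C mA mC; rewrite setIAC.
    transitivity (P (E `&` block k ((A, C) :: l))); first by rewrite /= -setIA.
    rewrite PE; last exact: measurable_block_cons.
    (* An unconstrained pair at index [k] turns a cylinder starting at [k.+1] into one starting at
       [k]. *)
    have := PE ((setT, setT) :: l).
    rewrite /= !preimage_setT !setTI => ->; last exact: measurable_block_cons.
    rewrite /block_weight !big_cons/= !probability_setT !mul1e.
    by rewrite -[RHS]muleA [in RHS](muleC _ (beta A * _)).
have key0 : P (E `&` (fun w => (Y k w, B k w)) @^-1` D) = P E * (beta \x alpha) D.
  by have := key [::]; rewrite /= setIT; apply.
split=> //; split.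
  by apply: measurableI => //; rewrite -[X in measurable X]setTI; exact: mYB.
move=> l ml; rewrite setIAC key// key0 muleAC; congr (_ * _).
have := PE ((setT, setT) :: l).
rewrite /= !preimage_setT !setTI => ->; last exact: measurable_block_cons.
by rewrite /block_weight !big_cons/= !probability_setT !mul1e.
Qed.

End stick_independence.

Section Rintegral_laws.
Context d (T : measurableType d) (R : realType).
Local Open Scope ereal_scope.

Lemma Rintegral_law d' (T' : measurableType d') (P : probability T R)
    (Q : probability T' R) (X : T -> T') (f : T' -> R) (M : R) :
  measurable_fun setT X -> (forall A, measurable A -> P (X @^-1` A) = Q A) ->
  measurable_fun setT f -> (forall x, `|f x| <= M)%R ->
  (\int[P]_w f (X w))%R = (\int[Q]_x f x)%R.
Proof.
move=> mX XQ mf fM; rewrite /Rintegral; congr fine.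
rewrite (eq_measure_integral (pushforward P X)); last first.
  by move=> A mA _; exact/esym/XQ.
rewrite integral_pushforward ?preimage_setT//; first exact/measurable_EFinP.
apply: (@bounded_integrable _ _ _ P _ M) => //.
exact: measurableT_comp.
Qed.

End Rintegral_laws.

Section stick_breaking.
Context d (T : measurableType d) (R : realType) (P : probability T R).
Variables (B Y : nat -> {RV P >-> R}) (beta alpha : probability R R).
Hypothesis indepBY : mutually_independent
  (fun i : nat + nat => match i with inl k => B k | inr k => Y k end).
Hypothesis lawB : forall k A, measurable A -> P (B k @^-1` A) = alpha A.
Hypothesis lawY : forall k A, measurable A -> P (Y k @^-1` A) = beta A.

(** Horner form of the partial sums: peeling off the pair [k] leaves 1 - Y k times the same sum for
    the shifted pairs, which is the shape of the fixed-point equation. *)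
Fixpoint stick_sum n k (w : T) : R :=
  if n is n'.+1 then Y k w * B k w + (1 - Y k w) * stick_sum n' k.+1 w else 0.

Lemma series_stick_sum n w :
  series (fun k => stick_weight Y k w * B k w) n = stick_sum n 0 w.
Proof.
suff H m k : \sum_(0 <= i < m) (Y (i + k)%N w * \prod_(j < i) (1 - Y (j + k)%N w))
    * B (i + k)%N w = stick_sum m k w.
  rewrite -H /series/=; apply: eq_big_nat => i _.
  rewrite /stick_weight addn0; congr (_ * _ * _).
  by apply: eq_bigr => j _; rewrite addn0.
elim: m k => [|m IH] k /=; first by rewrite big_geq.
rewrite big_nat_recl//= big_ord0 mulr1 add0n -IH big_distrr/=; congr (_ + _).
apply: eq_big_nat => i _; rewrite big_ord_recl/= add0n addSnnS.
rewrite (eq_bigr (fun j : 'I_i => 1 - Y (j + k.+1)%N w)); first ring.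
by move=> j _; rewrite /bump/= add1n addSnnS.
Qed.

Lemma measurable_stick_sum n k : measurable_fun setT (stick_sum n k).
Proof.
elim: n k => [|n IH] k //=.
apply: measurable_funD; first exact: measurable_funM.
by apply: measurable_funM => //; exact: measurable_funB.
Qed.

HB.instance Definition _ n k :=
  isMeasurableFun.Build _ _ _ _ (stick_sum n k) (measurable_stick_sum n k).

Definition stick_step (p : R * R * R) : R :=
  p.1.1 * p.1.2 + (1 - p.1.1) * p.2.

Lemma measurable_stick_step : measurable_fun setT stick_step.
Proof.
have m1 : measurable_fun setT (fun p : R * R * R => p.1.1).
  exact: measurableT_comp.
have m2 : measurable_fun setT (fun p : R * R * R => p.1.2).
  exact: measurableT_comp.
apply: measurable_funD; first exact: measurable_funM.
by apply: measurable_funM => //; exact: measurable_funB.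
Qed.

Local Open Scope ereal_scope.

(** Independence from the past and invariance of the law under shifts (the index 0 on the right) are
    proved together by induction on [n]: a sum of n + 1 terms is a function of the pair [k] and of
    an independent sum of n terms, whose law is already known not to depend on where it starts. *)
Lemma stick_sum_indep n k E D : indep_of_future B Y beta alpha k E ->
  measurable D ->
  P (E `&` stick_sum n k @^-1` D) = P E * distribution P (stick_sum n 0) D /\
  forall D', measurable D' ->
    P (E `&` (fun w => ((Y k w, B k w), stick_sum n k.+1 w)) @^-1` D') =
    P E * ((beta \x alpha) \x distribution P (stick_sum n 0)) D'.
Proof.
have step m : (forall k E D, indep_of_future B Y beta alpha k E ->
      measurable D ->
      P (E `&` stick_sum m k @^-1` D) = P E * distribution P (stick_sum m 0) D) ->
    forall k E, indep_of_future B Y beta alpha k E -> forall D', measurable D' ->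
    P (E `&` (fun w => ((Y k w, B k w), stick_sum m k.+1 w)) @^-1` D') =
    P E * ((beta \x alpha) \x distribution P (stick_sum m 0)) D'.
  move=> IH {}k {}E Ek D' mD'.
  apply: (@joint_law_unique _ _ _ _ _ _ _ P (beta \x alpha)%E) => //.
  - by case: Ek.
  - exact: measurable_fun_pair.
  - move=> A C mA mC; rewrite setIA.
    have [h1 h2] := indep_of_futureS mA Ek.
    by rewrite IH// h1 muleA.
have main m k' E' D' : indep_of_future B Y beta alpha k' E' -> measurable D' ->
    P (E' `&` stick_sum m k' @^-1` D') = P E' * distribution P (stick_sum m 0) D'.
  elim: m k' E' D' => [|m IH] k' E' D' Ek mD'.
    rewrite /distribution/= /pushforward.
    have [D0|D0] := pselect (D' 0%R).
      rewrite (_ : _ @^-1` _ = setT); last by apply/seteqP; split.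
      by rewrite setIT probability_setT mule1.
    rewrite (_ : _ @^-1` _ = set0); last by apply/seteqP; split.
    by rewrite setI0 measure0 mule0.
  have mD'' : measurable (stick_step @^-1` D').
    by rewrite -[X in measurable X]setTI; exact: measurable_stick_step.
  rewrite /distribution/= /pushforward.
  have := step m IH _ _ (indep_of_futureT indepBY lawB lawY) _ mD''.
  rewrite setTI probability_setT mul1e /= => ->.
  by rewrite -(step m IH _ _ Ek).
by move=> Ek mD; split; [exact: main|exact: (step n (main n))].
Qed.

Local Close Scope ereal_scope.

Lemma Rintegral_stick_sumS n (phi : R -> R) (M : R) :
  measurable_fun setT phi -> (forall x, `|phi x| <= M) ->
  \int[P]_w phi (stick_sum n.+1 0 w) =
  \int[(beta \x alpha)%E]_p \int[P]_w phi (stick_step (p, stick_sum n 0 w)).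
Proof.
move=> mphi phiM.
have mh := measurableT_comp mphi measurable_stick_step.
have hM p : `|(phi \o stick_step) p| <= M by exact: phiM.
transitivity (\int[((beta \x alpha) \x distribution P (stick_sum n 0))%E]_p
    (phi \o stick_step) p).
  apply: (@Rintegral_law _ _ _ _ _ P
    ((beta \x alpha) \x distribution P (stick_sum n 0))%E
    (fun w => ((Y 0 w, B 0 w), stick_sum n 1 w)) (phi \o stick_step) M) => //.
    by apply: measurable_fun_pair => //; exact: measurable_fun_pair.
  move=> A mA.
  have [_ /(_ A mA)] := stick_sum_indep n
    (indep_of_futureT indepBY lawB lawY) measurableT.
  by rewrite setTI probability_setT mul1e.
rewrite -(@Rintegral_prod12 _ _ _ _ _ (beta \x alpha)%E _ _ M)//.
apply: eq_Rintegral => p _.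
rewrite -(@Rintegral_law _ _ _ _ _ P _ (stick_sum n 0)
  (fun x => (phi \o stick_step) (p, x)) M)//.
by apply: (measurableT_comp mh); exact: measurable_fun_pair.
Qed.

Variable X : {RV P >-> R}.
Hypothesis cvgX : {ae P, forall w,
  series (fun k => stick_weight Y k w * B k w) n @[n --> \oo] --> X w}.
Hypothesis lawX : forall A, measurable A -> P (X @^-1` A) = alpha A.

(* If mu(t alpha) = alpha then alpha is the law of Y B + (1 - Y) B', where B, B'
   have law alpha and Y ~ beta(1, t) are independent. *)
Lemma stick_breaking_fixpoint (phi : R -> R) (M : R) :
  continuous phi -> (forall x, `|phi x| <= M) ->
  \int[alpha]_x phi x =
  \int[beta]_y \int[(alpha \x alpha)%E]_p phi (y * p.1 + (1 - y) * p.2).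
Proof.
move=> cphi phiM.
have mphi : measurable_fun setT phi by exact: continuous_measurable_fun.
have mh := measurableT_comp mphi measurable_stick_step.
have cvg_stick_sum : {ae P, forall w, stick_sum n 0 w @[n --> \oo] --> X w}.
  apply: filterS cvgX => w.
  rewrite (_ : (fun n => stick_sum n 0 w) =
    series (fun k => stick_weight Y k w * B k w))//.
  by apply/funext => n; rewrite series_stick_sum.
have cvg1 : \int[P]_w phi (stick_sum n 0 w) @[n --> \oo] --> \int[alpha]_x phi x.
  rewrite -(Rintegral_law _ lawX mphi phiM)//.
  apply: (@Rintegral_cvg_bounded _ _ _ _ _ _ M) => //.
  - by move=> n; exact: measurableT_comp.
  - exact: measurableT_comp.
  - by apply: filterS cvg_stick_sum => w Xw; exact: (cvg_comp _ _ Xw (cphi _)).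
have mstep n : measurable_fun setT (fun q : (R * R) * T =>
    phi (stick_step (q.1, stick_sum n 0 q.2))).
  apply: (measurableT_comp mh); apply: measurable_fun_pair => //.
  exact: measurableT_comp.
have mstepX : measurable_fun setT (fun q : (R * R) * T =>
    phi (stick_step (q.1, X q.2))).
  apply: (measurableT_comp mh); apply: measurable_fun_pair => //.
  exact: measurableT_comp.
(* Independence enters only through the truncated sums, in [Rintegral_stick_sumS]. The inner
   integral runs over a separate copy of the sample space, so [X] appears in the limit as an
   independent copy of itself. *)
have cvg2 : \int[P]_w phi (stick_sum n.+1 0 w) @[n --> \oo] -->
    \int[(beta \x alpha)%E]_p \int[P]_w phi (stick_step (p, X w)).
  under eq_fun do rewrite (Rintegral_stick_sumS _ mphi phiM).
  apply: (@Rintegral_cvg_bounded _ _ _ (beta \x alpha)%E _ _ M).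
  - move=> n; exact: (@measurable_Rintegral_fst _ _ _ _ _ (beta \x alpha)%E P
      (fun q => phi (stick_step (q.1, stick_sum n 0 q.2))) M).
  - exact: (@measurable_Rintegral_fst _ _ _ _ _ (beta \x alpha)%E P
      (fun q => phi (stick_step (q.1, X q.2))) M).
  - apply: aeW => p.
    apply: (@Rintegral_cvg_bounded _ _ _ _ _ _ M) => //.
    + move=> n; exact: (measurableT_comp (mstep n) (@pair1_measurable _ _ _ _ p)).
    + exact: (measurableT_comp mstepX (@pair1_measurable _ _ _ _ p)).
    + apply: filterS cvg_stick_sum => w Xw.
      have : stick_step (p, stick_sum n 0 w) @[n --> \oo] --> stick_step (p, X w).
        rewrite /stick_step/=; apply: cvgD; first exact: cvg_cst.
        by apply: cvgM; [exact: cvg_cst|exact: Xw].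
      by move=> h; exact: (cvg_comp _ _ h (cphi _)).
  - move=> n p; apply: Rintegral_bounded => //.
    exact: (measurableT_comp (mstep n) (@pair1_measurable _ _ _ _ p)).
have -> : \int[alpha]_x phi x =
    \int[(beta \x alpha)%E]_p \int[P]_w phi (stick_step (p, X w)).
  by move: cvg1; rewrite -cvg_shiftS => cvg1; exact: (cvg_unique _ cvg1 cvg2).
pose psi p := \int[alpha]_x phi (stick_step (p, x)).
have psiE p : \int[P]_w phi (stick_step (p, X w)) = psi p.
  apply: (@Rintegral_law _ _ _ _ _ P _ X (fun x => (phi \o stick_step) (p, x)) M) => //.
    exact: (measurableT_comp mh (@pair1_measurable _ _ _ _ p)).
  by move=> x; exact: phiM.
rewrite (@eq_Rintegral _ _ _ _ setT psi); last by move=> p _; exact: psiE.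
have mpsi : measurable_fun setT psi.
  exact: (@measurable_Rintegral_fst _ _ _ _ _ (beta \x alpha)%E alpha
      (fun p => phi (stick_step p)) M).
have psiM p : `|psi p| <= M.
  apply: Rintegral_bounded => //.
  exact: (measurableT_comp mh (@pair1_measurable _ _ _ _ p)).
rewrite -(@Rintegral_prod12 _ _ _ _ _ _ _ _ M)//.
apply: eq_Rintegral => y _.
rewrite -(@Rintegral_prod12 _ _ _ _ _ _ _ _ M)//.
have m1 : measurable_fun setT (fun p : R * R => y * p.1) by exact: measurable_funM.
have m2 : measurable_fun setT (fun p : R * R => (1 - y) * p.2).
  exact: measurable_funM.
by apply: (measurableT_comp mphi); exact: measurable_funD.
Qed.

End stick_breaking.

(** * Strict 1-stability *)

Section densities.
Context {R : realType}.
Notation mu := (@lebesgue_measure R).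

(* Probabilities on [R] and the Lebesgue measure live on two convertible
   measurable types with distinct displays: the identity transports the former
   to the latter. *)
Definition to_measurableTypeR : R -> measurableTypeR R := id.

Lemma measurable_to_measurableTypeR : measurable_fun setT to_measurableTypeR.
Proof. by move=> _ A mA; rewrite setTI. Qed.

HB.instance Definition _ := isMeasurableFun.Build _ _ _ _
  to_measurableTypeR measurable_to_measurableTypeR.

(** The Radon-Nikodym derivative of [m] has the same integral as [f] over every measurable set, so
    the two agree almost everywhere and [f] can replace it in the change of variables. *)
Lemma Rintegral_density (m : probability R R) (f g : R -> R) (M : R) :
  has_density m f -> (forall x, 0 <= f x) -> measurable_fun setT f ->
  measurable_fun setT g -> (forall x, `|g x| <= M) ->
  \int[m]_x g x = \int[mu]_x (g x * f x).
Proof.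
move=> mfE f0 mf mg gM.
pose m' := distribution m to_measurableTypeR.
have mf' : measurable_fun setT (f : measurableTypeR R -> R) by [].
have mg' : measurable_fun setT (g : measurableTypeR R -> R) by [].
have mEf : measurable_fun setT (EFin \o f : measurableTypeR R -> \bar R).
  by apply: measurableT_comp.
have mEg : measurable_fun setT (EFin \o g : measurableTypeR R -> \bar R).
  by apply: measurableT_comp.
have m'E A : measurable A -> m' A = (\int[mu]_(x in A) (f x)%:E)%E by exact: mfE.
have dom : m' `<< mu.
  apply/null_content_dominatesP => A mA A0.
  by rewrite m'E//; apply: null_set_integral => //; exact: measurable_funTS.
have intf : mu.-integrable setT (EFin \o f).
  apply/integrableP; split => //.
  under eq_integral do rewrite /= ger0_norm//.
  by rewrite -m'E// -ge0_fin_numE// fin_num_measure.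
rewrite (@Rintegral_law _ _ _ _ _ m m' to_measurableTypeR g M)//.
congr fine; rewrite -(Radon_Nikodym_change_of_variables dom)//=; last first.
  exact: (bounded_integrable m' mg' gM).
apply: ae_eq_integral => //.
- by apply: emeasurable_funM => //; apply: (measurable_int mu);
    exact: Radon_Nikodym_integrable.
- by apply/measurable_EFinP; exact: measurable_funM.
- under [X in ae_eq _ _ _ X]eq_fun do rewrite EFinM.
  apply: ae_eqe_mul2l.
  rewrite Radon_NikodymE//=.
  case: cid => /= h [h1 h2 h3].
  apply: integral_ae_eq => //=.
  by move=> E _ mE; rewrite -h3//= -m'E.
Qed.

End densities.

(** * Continuous functions on [0, 1] with vanishing moments *)

Section moments.
Context {R : realType}.
Notation mu := (@lebesgue_measure R).

Lemma continuous_integrable_itv (a b : R) (f : R -> R) : continuous f ->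
  mu.-integrable `[a, b] (EFin \o f).
Proof.
move=> cf; apply: continuous_compact_integrable; first exact: segment_compact.
exact: continuous_subspaceT.
Qed.

Lemma integrable_EFinB (D : set R) (f g : R -> R) : measurable D ->
  mu.-integrable D (EFin \o f) -> mu.-integrable D (EFin \o g) ->
  mu.-integrable D (EFin \o (fun x => f x - g x)).
Proof.
move=> mD intf intg.
rewrite (_ : _ \o _ = ((EFin \o f) \- (EFin \o g))%E); first exact: integrableB.
by apply/funext => x; rewrite /= EFinB.
Qed.

Lemma integrable_indic_scale (D : set R) (a b c : R) : measurable D ->
  mu.-integrable D (EFin \o (fun z => c * \1_`[a, b] z)).
Proof.
move=> mD; rewrite (_ : _ \o _ = fun z => (c%:E * (\1_`[a, b] z)%:E)%E)//.
apply: integrableZl => //.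
apply: (integrableS measurableT) => //.
exact: (integrable_indic_itv a b true false).
Qed.

Lemma continuous_onemX n : continuous (fun y : R => (1 - y) ^+ n).
Proof.
move=> y; apply: (@continuous_comp _ _ _ (fun y : R => 1 - y) (fun y => y ^+ n)).
  by apply: cvgB; [exact: cvg_cst|exact: cvg_id].
exact: exprn_continuous.
Qed.

Lemma continuous_horner_onem (p : {poly R}) :
  continuous (fun y : R => p.[1 - y]).
Proof.
elim/poly_ind: p => [|p c IH] y.
  by under eq_fun do rewrite horner0; exact: cvg_cst.
under eq_fun do rewrite !hornerE.
apply: cvgD; last exact: cvg_cst.
by apply: cvgM; [exact: IH|apply: cvgB; [exact: cvg_cst|exact: cvg_id]].
Qed.

(** The induction varies [K]: multiplying it by 1 - y shifts its moments and so preserves their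
    vanishing. *)
Lemma vanishing_moments_poly (K : R -> R) (p : {poly R}) : continuous K ->
  (forall n, \int[mu]_(y in `[0, 1]) (K y * (1 - y) ^+ n) = 0) ->
  \int[mu]_(y in `[0, 1]) (K y * p.[1 - y]) = 0.
Proof.
elim/poly_ind: p K => [|p c IH] K cK K0.
  under eq_Rintegral do rewrite horner0 mulr0.
  by rewrite Rintegral_cst// mul0r.
have cK' : continuous (fun y => K y * (1 - y)).
  move=> y; apply: cvgM; first exact: cK.
  by apply: cvgB; [exact: cvg_cst|exact: cvg_id].
transitivity (\int[mu]_(y in `[0, 1])
    (K y * (1 - y) * p.[1 - y] + c * (K y * (1 - y) ^+ 0))).
  by apply: eq_Rintegral => y _; rewrite hornerMXaddC expr0; ring.
have cKp : continuous (fun y => K y * (1 - y) * p.[1 - y]).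
  by move=> y; apply: cvgM; [exact: cK'|exact: continuous_horner_onem].
have cK1 : continuous (fun y => K y * (1 - y) ^+ 0).
  by move=> y; apply: cvgM; [exact: cK|exact: continuous_onemX].
rewrite RintegralD//.
- rewrite RintegralZl//; last exact: continuous_integrable_itv.
  rewrite K0 mulr0 addr0 IH// => n.
  by under eq_Rintegral do rewrite -mulrA -exprS; exact: K0.
- exact: continuous_integrable_itv.
- apply: continuous_integrable_itv => y.
  by apply: cvgM; [exact: cvg_cst|exact: cK1].
Qed.

Lemma continuous_dist_lt (f : R -> R) (x c : R) : continuous f -> 0 < c ->
  exists2 e, 0 < e & forall y, `|y - x| < e -> `|f y - f x| < c.
Proof.
move=> cf c0; have /cvgrPdist_lt/(_ _ c0)/nbhs_ballP[e /= e0 he] := cf x.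
exists e => // y yx; rewrite distrC; apply: he.
by rewrite /ball/= distrC.
Qed.

(** There are three zones. For |t| <= d / 2 the base is at least 1 + d^2 / 4; up to d it is
    nonnegative and so is [k]; beyond d it lies in [0, 1], so that the product is at least -M. *)
Lemma bump_power_ge (k c M d t : R) m : 0 < d <= 1 -> `|t| <= 1 -> 0 < c ->
  `|k| <= M -> (`|t| <= d -> c <= k) ->
  c * (1 + d ^+ 2 / 4) ^+ m * (`|t| <= d / 2)%R%:R - M <=
    k * (1 + d ^+ 2 / 2 - t ^+ 2) ^+ m.
Proof.
move=> /andP[d0 d1] t1 c0 kM ck.
have M0 : 0 <= M by exact: le_trans kM.
rewrite -(real_normK (num_real t)); move: `|t| (normr_ge0 t) t1 ck => {}t t0 t1 ck.
have [td2|_] := leP t (d / 2).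
  rewrite mulr1; apply: (@le_trans _ _ (c * (1 + d ^+ 2 / 4) ^+ m)).
    by rewrite gerBl.
  apply: ler_pM; [exact: ltW|by rewrite exprn_ge0//; nra|by apply: ck; lra|].
  by apply: lerXn2r; rewrite ?nnegrE; nra.
rewrite mulr0 sub0r; have [td|dt] := leP t d.
  apply: (@le_trans _ _ 0); first by rewrite oppr_le0.
  by rewrite mulr_ge0 ?exprn_ge0 ?(le_trans (ltW c0) (ck td))//; nra.
rewrite lerNl; apply: le_trans kM; rewrite -mulNr.
apply: (le_trans (ler_norm _)); rewrite normrM normrN ler_piMr//.
have q0 : 0 <= 1 + d ^+ 2 / 2 - t ^+ 2 by nra.
by rewrite normrX exprn_ile1// ger0_norm//; nra.
Qed.

(* If H(y) > 0, test H against large powers of a polynomial that exceeds 1 near y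
   and takes values in [0, 1] away from y. *)
Lemma vanishing_moments_eq0 (H : R -> R) N : continuous H ->
  (forall n, (N <= n)%N -> \int[mu]_(y in `[0, 1]) (H y * (1 - y) ^+ n) = 0) ->
  forall y, 0 <= y <= 1 -> H y = 0.
Proof.
move=> cH H0 y0 /andP[y00 y01]; apply/eqP/negPn/negP => Hy0.
(* A bump needs room on both sides, so the point is moved slightly towards 1/2, where [H] is still
   nonzero by continuity. *)
have [y [/andP[yge0 ylt1] Hy]] : exists y, 0 < y < 1 /\ H y != 0.
  have Hy0' : 0 < `|H y0| by rewrite normr_gt0.
  have [e e0 he] := continuous_dist_lt y0 cH Hy0'.
  pose th := Num.min e 1.
  have th0 : 0 < th by rewrite lt_min e0 ltr01.
  have the : th <= e by rewrite ge_min lexx.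
  have th1 : th <= 1 by rewrite ge_min lexx orbT.
  exists (y0 + th * (2^-1 - y0)); split; first by apply/andP; split; nra.
  apply/eqP => Hz.
  have : `|y0 + th * (2^-1 - y0) - y0| < e.
    by rewrite addrAC subrr add0r ltr_norml; apply/andP; split; nra.
  by move/he; rewrite Hz sub0r normrN ltxx.
(* The sign makes K(y) positive, and the factor (1 - z)^N shifts the moments past the uncontrolled
   ones: all moments of [K] vanish. *)
pose K z := Num.sg (H y) * H z * (1 - z) ^+ N.
have cK : continuous K.
  move=> z; apply: cvgM; last exact: continuous_onemX.
  by apply: cvgM; [exact: cvg_cst|exact: cH].
have K0 n : \int[mu]_(y in `[0, 1]) (K y * (1 - y) ^+ n) = 0.
  under eq_Rintegral => z _ do rewrite /K -!mulrA -exprD.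
  rewrite RintegralZl//; first by rewrite H0 ?mulr0// leq_addr.
  apply: continuous_integrable_itv => z.
  by apply: cvgM; [exact: cH|exact: continuous_onemX].
have Ky : 0 < K y.
  apply: mulr_gt0; last by rewrite exprn_gt0 ?subr_gt0.
  by rewrite -normrEsg normr_gt0.
have Ky2 : 0 < K y / 2 by rewrite divr_gt0.
have [e e0 he] := continuous_dist_lt y cK Ky2.
(* This [d] ensures both [K >= K y / 2] within distance d of y and that the peak zone, of radius d /
   2, stays inside [0, 1]. *)
pose d := Num.min (e / 2) (Num.min y (1 - y)).
have d0 : 0 < d by rewrite !lt_min divr_gt0// yge0 subr_gt0.
have de : d <= e / 2 by rewrite ge_min lexx.
have dy : d <= y by rewrite !ge_min lexx orbT.
have d1y : d <= 1 - y by rewrite !ge_min lexx !orbT.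
have Kd z : `|z - y| <= d -> K y / 2 <= K z.
  move=> zd; have : `|z - y| < e by lra.
  by move/he; rewrite ltr_norml => /andP[+ _]; lra.
have [M KM] : exists M, forall z, z \in `[0, 1] -> `|K z| <= M.
  have cNK : continuous (fun z => `|K z|).
    by move=> z; exact: (continuous_comp (cK z) (@norm_continuous _ _ _)).
  have [c _ hM] := EVT_max ler01 (continuous_subspaceT cNK).
  by exists `|K c| => z /hM.
have M0 : 0 <= M.
  by apply: le_trans (KM 0 _); rewrite ?normr_ge0// in_itv/= lexx ler01.
pose A := 1 + d ^+ 2 / 4.
have A1 : 1 < A by rewrite /A ltrDl divr_gt0// exprn_gt0.
(* The gain [K y / 2 * A ^+ m] on the peak zone, an interval of length d, must exceed the loss M on
   [0, 1]. Bernoulli's inequality [AX] provides the exponent. *)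
have [m hm] : exists m : nat, M < K y / 2 * A ^+ m * d.
  have x0 : 0 < d ^+ 2 / 4 by rewrite divr_gt0// exprn_gt0.
  have AX n : 1 + n%:R * (d ^+ 2 / 4) <= A ^+ n.
    elim: n => [|n IH]; first by rewrite mul0r addr0 expr0.
    rewrite [leRHS]exprS -natr1.
    apply: (@le_trans _ _ (A * (1 + n%:R * (d ^+ 2 / 4)))).
      have := mulr_ge0 (ler0n R n) (sqr_ge0 (d ^+ 2 / 4)).
      by rewrite /A; lra.
    by rewrite ler_pM2l// (lt_trans ltr01).
  pose c := K y / 2 * d * (d ^+ 2 / 4).
  have c0 : 0 < c by exact: mulr_gt0 (mulr_gt0 Ky2 d0) x0.
  exists (Num.bound (M / c)).
  have := @archi_boundP _ (M / c) (divr_ge0 M0 (ltW c0)).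
  rewrite ltr_pdivrMr// /c => h; apply: (lt_le_trans h).
  rewrite [leRHS]mulrAC mulrCA ler_pM2l ?(mulr_gt0 Ky2 d0)//.
  by apply: le_trans (AX _); rewrite lerDr.
pose q : {poly R} := (1 + d ^+ 2 / 2)%:P - ('X - (1 - y)%:P) ^+ 2.
have qE z : q.[1 - z] = 1 + d ^+ 2 / 2 - (z - y) ^+ 2.
  by rewrite /q !hornerE; ring.
have := vanishing_moments_poly (q ^+ m) cK K0.
apply/eqP; rewrite gt_eqF//.
pose I := `[y - d / 2, y + d / 2]%classic.
pose L z := K y / 2 * A ^+ m * \1_I z - M.
have intcI : mu.-integrable `[0, 1] (EFin \o (fun z => K y / 2 * A ^+ m * \1_I z)).
  exact: integrable_indic_scale.
have intM : mu.-integrable `[0, 1] (EFin \o (fun=> M)).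
  by apply: continuous_integrable_itv => z; exact: cvg_cst.
have intL : mu.-integrable `[0, 1] (EFin \o L).
  by apply: integrable_EFinB.
have intK : mu.-integrable `[0, 1] (EFin \o (fun z => K z * (q ^+ m).[1 - z])).
  apply: continuous_integrable_itv => z.
  by apply: cvgM; [exact: cK|exact: continuous_horner_onem].
apply: (@lt_le_trans _ _ (\int[mu]_(z in `[0, 1]) L z)).
  rewrite RintegralB// RintegralZl//; last first.
    apply: (integrableS measurableT) => //.
    exact: (integrable_indic_itv _ _ true false).
  have -> : \int[mu]_(z in `[0, 1]) \1_I z = d.
    rewrite /Rintegral integral_indic//; last exact: measurable_itv.
    rewrite setIidl; last first.
      by move=> z; rewrite /I/= !in_itv/= => /andP[? ?]; apply/andP; split; lra.
    rewrite /I/= lebesgue_measure_itv/= lte_fin ifT; last by lra.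
    by rewrite -EFinD/=; lra.
  rewrite Rintegral_cst//= lebesgue_measure_itv/= lte01 -EFinD/= oppr0 addr0.
  by rewrite mulr1 subr_gt0.
apply: le_Rintegral => // z; rewrite /= in_itv/= => /andP[z0 z1].
rewrite /L horner_exp qE.
have -> : \1_I z = (`|z - y| <= d / 2)%R%:R :> R.
  by rewrite indicE mem_setE in_itv/= ler_distl.
apply: bump_power_ge => //; last 2 first.
- by rewrite KM// in_itv/= z0.
- exact: Kd.
- by rewrite d0/=; lra.
- by rewrite ler_distlC; apply/andP; split; lra.
Qed.

End moments.

(** * Invariance under convex combinations of independent copies *)

Section stability.
Context {R : realType}.
Notation mu := (@lebesgue_measure R).

Lemma beta1_pdf_natE m :
  beta1_pdf (m.+1%:R : R) = (fun y : R => m.+1%:R * (1 - y) ^+ m) \_ `]0, 1[.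
Proof.
apply/funext => y; rewrite /beta1_pdf !patchE; case: ifPn => //.
rewrite inE/= in_itv/= => /andP[y0 y1].
by rewrite -natr1 addrK powR_mulrn// subr_ge0 ltW.
Qed.

Lemma beta1_pdf_ge0 m (y : R) : 0 <= beta1_pdf (m.+1%:R : R) y.
Proof.
rewrite beta1_pdf_natE patchE; case: ifPn => //.
by rewrite inE/= in_itv/= => /andP[y0 y1]; rewrite mulr_ge0// exprn_ge0// subr_ge0 ltW.
Qed.

Lemma measurable_beta1_pdf m : measurable_fun setT (beta1_pdf (m.+1%:R : R)).
Proof.
rewrite beta1_pdf_natE; apply/(measurable_restrictT _ _).1 => //.
apply: measurable_funTS; apply: continuous_measurable_fun => y.
by apply: cvgM; [exact: cvg_cst|exact: continuous_onemX].
Qed.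

Variable alpha : probability R R.

Lemma continuous_mix (phi : R -> R) (M : R) : continuous phi ->
  (forall x, `|phi x| <= M) ->
  continuous (fun y : R => \int[(alpha \x alpha)%E]_p phi (y * p.1 + (1 - y) * p.2)).
Proof.
move=> cphi phiM y; apply/continuous_withinNx/cvgr_dnbhsP => u [_ uy].
have mmix z : measurable_fun setT (fun p : R * R => phi (z * p.1 + (1 - z) * p.2)).
  apply: (measurableT_comp (continuous_measurable_fun cphi)).
  by apply: measurable_funD; exact: measurable_funM.
apply: (@Rintegral_cvg_bounded _ _ _ _ _ _ M) => //.
apply: aeW => p.
have : u n * p.1 + (1 - u n) * p.2 @[n --> \oo] --> y * p.1 + (1 - y) * p.2.
  by apply: cvgD; apply: cvgM; [exact: uy|exact: cvg_cst|
    apply: cvgB; [exact: cvg_cst|exact: uy]|exact: cvg_cst].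
by move=> h; exact: (cvg_comp _ _ h (cphi _)).
Qed.

(** The density of beta(1, m + 1) on (0, 1) is (m + 1) (1 - y)^m, so the fixed-point equation at t =
    m + 1 is the moment of order m, up to the factor m + 1. *)
Lemma mix_moment m (phi : R -> R) (M : R) : is_mu (m.+1%:R : R) alpha alpha ->
  continuous phi -> (forall x, `|phi x| <= M) ->
  \int[mu]_(y in `[0, 1])
    ((\int[(alpha \x alpha)%E]_p phi (y * p.1 + (1 - y) * p.2) -
      \int[alpha]_x phi x) * (1 - y) ^+ m) = 0.
Proof.
move=> [d [T [P [B [Y [X [indepBY lawB lawY cvgX lawX]]]]]]] cphi phiM.
have := @stick_breaking_fixpoint _ _ _ P B Y (distribution P (Y 0%N)) alpha
  indepBY lawB _ X cvgX lawX phi M cphi phiM.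
have h : forall k A, measurable A -> P (Y k @^-1` A) = distribution P (Y 0%N) A.
  by move=> k A mA; rewrite -[LHS]/(distribution P (Y k) A) !lawY.
move=> /(_ h) {h}.
set G := (fun y => \int[(alpha \x alpha)%E]_p _); set c := \int[alpha]_x phi x.
move=> cE.
have cG : continuous G by exact: continuous_mix cphi phiM.
have GM y : `|G y| <= M.
  apply: Rintegral_bounded => //.
  apply: (measurableT_comp (continuous_measurable_fun cphi)).
  by apply: measurable_funD; exact: measurable_funM.
have cGc : continuous (fun y => G y - c).
  by move=> y; apply: cvgB; [exact: cG|exact: cvg_cst].
have mG := continuous_measurable_fun cG.
have : \int[distribution P (Y 0%N)]_y (G y - c) = 0.
  rewrite RintegralB//; last 2 first.
  - exact: (bounded_integrable _ mG GM).
  - by apply: (@bounded_integrable _ _ _ _ _ `|c|).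
  by rewrite Rintegral_cst// [X in fine X]probability_setT/= mulr1 -cE subrr.
rewrite (Rintegral_density (lawY 0%N) (@beta1_pdf_ge0 m) (@measurable_beta1_pdf m)
  (continuous_measurable_fun cGc) (M := M + `|c|)); last first.
  by move=> x; rewrite (le_trans (ler_normB _ _))// lerD.
move=> H0.
have : \int[mu]_(y in `]0, 1[) (m.+1%:R * ((G y - c) * (1 - y) ^+ m)) = 0.
  rewrite -[RHS]H0 Rintegral_mkcond; apply: eq_Rintegral => y _.
  rewrite beta1_pdf_natE !patchE; case: ifPn => _; last by rewrite mulr0.
  by rewrite mulrCA.
have cGm : continuous (fun y => (G y - c) * (1 - y) ^+ m).
  by move=> y; apply: cvgM; [exact: cGc|exact: continuous_onemX].
have icc : mu.-integrable `[0, 1] (EFin \o (fun y => (G y - c) * (1 - y) ^+ m)).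
  exact: continuous_integrable_itv.
rewrite RintegralZl//; last first.
  by apply: (integrableS _ _ _ icc) => //; exact: subset_itv_oo_cc.
rewrite Rintegral_itv_obnd_cbnd ?Rintegral_itv_bndo_bndc//.
- by move=> /eqP; rewrite mulf_eq0 pnatr_eq0/= => /eqP.
- by apply: (integrableS _ _ _ icc) => //; exact: subset_itv_co_cc.
- by apply: (integrableS _ _ _ icc) => //; exact: subset_itv_oo_cc.
Qed.

Lemma mix_invariant (N : int) (phi : R -> R) (M : R) :
  (forall n : int, N <= n -> 1 <= n -> is_mu (n%:~R : R) alpha alpha) ->
  continuous phi -> (forall x, `|phi x| <= M) ->
  forall y, 0 <= y <= 1 ->
  \int[(alpha \x alpha)%E]_p phi (y * p.1 + (1 - y) * p.2) = \int[alpha]_x phi x.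
Proof.
move=> mu_alpha cphi phiM y y01; apply/eqP; rewrite -subr_eq0; apply/eqP.
(* As [N] may be negative, the moments are taken from its absolute value on; the moment of order n
   uses the parameter n + 1, which is at least 1. *)
apply: (@vanishing_moments_eq0 _ (fun y => \int[(alpha \x alpha)%E]_p
  phi (y * p.1 + (1 - y) * p.2) - \int[alpha]_x phi x) `|N|%N) => //.
- by move=> z; apply: cvgB; [exact: continuous_mix cphi phiM z|exact: cvg_cst].
- move=> n Nn; apply: (mix_moment (M := M)) => //.
  apply: (mu_alpha n.+1%:Z); last by [].
  by rewrite (le_trans (ler_norm N))// -abszE lez_nat leqW.
Qed.

End stability.

(** * The Cauchy transform *)

Section feynman.
Context {R : realType}.
Notation mu := (@lebesgue_measure R).

Lemma FTC_segment (f F : R -> R) (a b : R) : a < b ->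
  (forall y, a <= y <= b -> is_derive y 1 F (f y)) ->
  (forall y, a <= y <= b -> {for y, continuous f}) ->
  \int[mu]_(y in `[a, b]) f y = F b - F a.
Proof.
move=> ab dF cf; rewrite /Rintegral (@continuous_FTC2 _ f F)//.
- apply: continuous_in_subspaceT => y.
  by rewrite inE/= in_itv/= => yab; exact: cf.
- have cF y : a <= y <= b -> {for y, continuous F}.
    by move=> /dF h; apply/differentiable_continuous/derivable1_diffP.
  split.
  + move=> y; rewrite in_itv/= => /andP[/ltW ay /ltW yb].
    by have [] := dF y; rewrite ?ay.
  + by apply: cvg_at_right_filter; apply: cF; rewrite lexx ltW.
  + by apply: cvg_at_left_filter; apply: cF; rewrite lexx ltW.
- move=> y; rewrite in_itv/= => /andP[/ltW ay /ltW yb].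
  have h : is_derive y 1 F (f y) by apply: dF; rewrite ay.
  by rewrite derive1E derive_val.
Qed.

Lemma is_derive_quadratic (a b c y : R) :
  is_derive y 1 (fun y : R => a + b * y + c * y ^+ 2) (b + 2 * c * y).
Proof.
have hid : is_derive y 1 (id : R -> R) 1 by exact: is_derive_id.
have hZ k : is_derive y 1 (fun y : R => k * y) k.
  by apply: (is_derive_eq (is_deriveZ k hid)); rewrite /GRing.scale/= mulr1.
have h1 : is_derive y 1 (fun y : R => a + b * y) b.
  by apply: (is_derive_eq (is_deriveD (is_derive_cst a y 1) (hZ b))); rewrite add0r.
have h2 : is_derive y 1 (fun y : R => c * y ^+ 2) (2 * c * y).
  rewrite (_ : (fun y : R => c * y ^+ 2) = (fun y => c * y) * (id : R -> R)).
    by apply: (is_derive_eq (is_deriveM (hZ c) hid)); rewrite /GRing.scale/=; ring.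
  by apply/funext => z /=; rewrite expr2 mulrA.
exact: (is_deriveD h1 h2).
Qed.

Lemma is_derive_div (f g : R -> R) (df dg y : R) : g y != 0 ->
  is_derive y 1 f df -> is_derive y 1 g dg ->
  is_derive y 1 (fun y => f y / g y) ((df * g y - f y * dg) / g y ^+ 2).
Proof.
move=> g0 hf hg.
have hV : is_derive y 1 (fun y => (g y)^-1) (- (g y) ^- 2 *: dg).
  by apply: DeriveDef; [exact: derivableV|rewrite deriveV// derive_val].
apply: (is_derive_eq (is_deriveM hf hV)).
by rewrite /GRing.scale/=; field.
Qed.

(** [re_inv] is the real part of 1 / (p + i q) and [im_inv] is minus its imaginary part, so that
    both have the signs of their numerators. *)
Definition re_inv (p q : R) : R := p / (p ^+ 2 + q ^+ 2).
Definition im_inv (p q : R) : R := q / (p ^+ 2 + q ^+ 2).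

Lemma sqr_add_gt0 (p q : R) : 0 < q -> 0 < p ^+ 2 + q ^+ 2.
Proof. by move=> q0; rewrite ltr_wpDl ?sqr_ge0// exprn_gt0. Qed.

Lemma segment_gt0 (q0 q1 y : R) : 0 < q0 -> 0 < q1 -> 0 <= y <= 1 ->
  0 < q0 + y * (q1 - q0).
Proof.
move=> q00 q10 /andP[y0 y1].
rewrite (_ : _ + _ = (1 - y) * q0 + y * q1); last by ring.
move: y0; rewrite le_eqVlt => /predU1P[<-|y0].
  by rewrite subr0 mul1r mul0r addr0.
by rewrite ltr_wpDl ?mulr_gt0// mulr_ge0 ?subr_ge0// ltW.
Qed.

(* The two parts of d/dy (y / (z0 z_y)) = 1 / z_y^2, where z0 = p0 + i q0,
   z1 = p1 + i q1 and z_y = z0 + y (z1 - z0). *)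
Lemma is_derive_segment (p0 p1 q0 q1 y : R) (P := fun y => p0 + y * (p1 - p0))
    (Q := fun y => q0 + y * (q1 - q0)) :
  0 < q0 -> 0 < Q y ->
  is_derive y 1
    (fun y => y * (re_inv p0 q0 * re_inv (P y) (Q y) -
                   im_inv p0 q0 * im_inv (P y) (Q y)))
    (re_inv (P y) (Q y) ^+ 2 - im_inv (P y) (Q y) ^+ 2) /\
  is_derive y 1
    (fun y => y * (re_inv p0 q0 * im_inv (P y) (Q y) +
                   im_inv p0 q0 * re_inv (P y) (Q y)))
    (2 * re_inv (P y) (Q y) * im_inv (P y) (Q y)).
Proof.
move=> q00 Qy0.
have N0 := lt0r_neq0 (sqr_add_gt0 p0 q00).
(* Along the segment the squared modulus is quadratic in z. Both parts of z / (z0 z_z) are then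
   quotients of quadratics, with numerators vanishing at 0. *)
have NE z : P z ^+ 2 + Q z ^+ 2 = (p0 ^+ 2 + q0 ^+ 2) +
    (2 * (p0 * (p1 - p0) + q0 * (q1 - q0))) * z +
    ((p1 - p0) ^+ 2 + (q1 - q0) ^+ 2) * z ^+ 2 by rewrite /P /Q; ring.
have Ny := lt0r_neq0 (sqr_add_gt0 (P y) Qy0).
have Ny' := Ny; rewrite NE in Ny'.
have quot a b := @is_derive_div (fun z => 0 + a * z + b * z ^+ 2) (fun z =>
    (p0 ^+ 2 + q0 ^+ 2) + (2 * (p0 * (p1 - p0) + q0 * (q1 - q0))) * z +
    ((p1 - p0) ^+ 2 + (q1 - q0) ^+ 2) * z ^+ 2) _ _ y Ny'
  (is_derive_quadratic 0 a b y) (is_derive_quadratic _ _ _ y).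
split.
- have := quot ((p0 ^+ 2 - q0 ^+ 2) / (p0 ^+ 2 + q0 ^+ 2))
    ((p0 * (p1 - p0) - q0 * (q1 - q0)) / (p0 ^+ 2 + q0 ^+ 2)).
  rewrite (_ : (fun z => _ / _) = fun z => z * (re_inv p0 q0 * re_inv (P z) (Q z) -
      im_inv p0 q0 * im_inv (P z) (Q z))); last first.
    by apply/funext => z; rewrite /re_inv /im_inv -NE /P /Q; ring.
  move=> h; apply: (is_derive_eq h).
  rewrite -NE /re_inv /im_inv; move: Ny; rewrite /P /Q => Ny; field.
  by rewrite Ny N0.
- have := quot (2 * p0 * q0 / (p0 ^+ 2 + q0 ^+ 2))
    ((p0 * (q1 - q0) + q0 * (p1 - p0)) / (p0 ^+ 2 + q0 ^+ 2)).
  rewrite (_ : (fun z => _ / _) = fun z => z * (re_inv p0 q0 * im_inv (P z) (Q z) +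
      im_inv p0 q0 * re_inv (P z) (Q z))); last first.
    by apply/funext => z; rewrite /re_inv /im_inv -NE /P /Q; ring.
  move=> h; apply: (is_derive_eq h).
  rewrite -NE /re_inv /im_inv; move: Ny; rewrite /P /Q => Ny; field.
  by rewrite Ny N0.
Qed.

Lemma continuous_re_inv (f g : R -> R) (y : R) : {for y, continuous f} ->
  {for y, continuous g} -> 0 < g y -> {for y, continuous (fun y => re_inv (f y) (g y))}.
Proof.
move=> cf cg g0; apply: cvgM; first exact: cf.
apply: cvgV; first by rewrite lt0r_neq0// sqr_add_gt0.
by apply: cvgD; rewrite !expr2; apply: cvgM.
Qed.

Lemma continuous_im_inv (f g : R -> R) (y : R) : {for y, continuous f} ->
  {for y, continuous g} -> 0 < g y -> {for y, continuous (fun y => im_inv (f y) (g y))}.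
Proof.
move=> cf cg g0; apply: cvgM; first exact: cg.
apply: cvgV; first by rewrite lt0r_neq0// sqr_add_gt0.
by apply: cvgD; rewrite !expr2; apply: cvgM.
Qed.

(* Feynman's identity: the integral of 1 / z_y^2 over [0, 1] is 1 / (z0 z1). *)
Lemma Feynman_segment (p0 p1 q0 q1 : R) (P := fun y => p0 + y * (p1 - p0))
    (Q := fun y => q0 + y * (q1 - q0)) :
  0 < q0 -> 0 < q1 ->
  \int[mu]_(y in `[0, 1]) (re_inv (P y) (Q y) ^+ 2 - im_inv (P y) (Q y) ^+ 2) =
    re_inv p0 q0 * re_inv p1 q1 - im_inv p0 q0 * im_inv p1 q1 /\
  \int[mu]_(y in `[0, 1]) (2 * re_inv (P y) (Q y) * im_inv (P y) (Q y)) =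
    re_inv p0 q0 * im_inv p1 q1 + im_inv p0 q0 * re_inv p1 q1.
Proof.
move=> q00 q10.
have Q0 y : 0 <= y <= 1 -> 0 < Q y by exact: segment_gt0.
have c1 a b y : {for y, continuous (fun y : R => a + y * b)}.
  apply: cvgD; first exact: cvg_cst.
  by apply: cvgM; [exact: cvg_id|exact: cvg_cst].
have cre y : 0 <= y <= 1 -> {for y, continuous (fun y => re_inv (P y) (Q y))}.
  by move=> /Q0 Qy; apply: continuous_re_inv; [exact: c1|exact: c1|].
have cim y : 0 <= y <= 1 -> {for y, continuous (fun y => im_inv (P y) (Q y))}.
  by move=> /Q0 Qy; apply: continuous_im_inv; [exact: c1|exact: c1|].
have P1 : P 1 = p1 by rewrite /P; ring.
have Q1 : Q 1 = q1 by rewrite /Q; ring.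
split.
- have /= -> := FTC_segment ltr01
    (fun y y01 => (@is_derive_segment p0 p1 q0 q1 y q00 (Q0 y y01)).1).
    by rewrite -/(P 1) -/(Q 1) P1 Q1 mul0r mul1r subr0.
  move=> y y01; apply: cvgB; rewrite expr2; apply: cvgM.
  + exact: cre.
  + exact: cre.
  + exact: cim.
  + exact: cim.
- have /= -> := FTC_segment ltr01
    (fun y y01 => (@is_derive_segment p0 p1 q0 q1 y q00 (Q0 y y01)).2).
    by rewrite -/(P 1) -/(Q 1) P1 Q1 mul0r mul1r subr0.
  move=> y y01; apply: cvgM; last exact: cim.
  by apply: cvgM; [exact: cvg_cst|exact: cre].
Qed.

End feynman.

(** * Products of Cauchy transforms *)

Section resolvent.
Context {R : realType}.
Notation mu := (@lebesgue_measure R).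

Definition of_measurableTypeR : measurableTypeR R -> R := id.

Lemma measurable_of_measurableTypeR : measurable_fun setT of_measurableTypeR.
Proof. by move=> _ A mA; rewrite setTI. Qed.

HB.instance Definition _ := isMeasurableFun.Build _ _ _ _
  of_measurableTypeR measurable_of_measurableTypeR.

(** Turns the integral over [0, 1] into an integral against a probability, so that the Fubini lemmas
    for bounded functions apply to it. *)
Definition unif01 : probability R R :=
  distribution (uniform_prob (@ltr01 R)) of_measurableTypeR.

Lemma Rintegral_unif01 (g : R -> R) (M : R) : measurable_fun setT g ->
  (forall x, `|g x| <= M) ->
  \int[unif01]_x g x = \int[mu]_(x in `[0, 1]) g x.
Proof.
move=> mg gM; rewrite [RHS]Rintegral_mkcond.
rewrite (@Rintegral_density _ unif01 (\1_`[0, 1]) g M)//.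
- by apply: eq_Rintegral => x _; rewrite patchE indicE; case: ifPn; rewrite ?mulr1 ?mulr0.
- move=> A mA; rewrite /unif01 /distribution /pushforward /uniform_prob.
  apply: eq_integral => x _; rewrite /uniform_pdf indicE subr0 invr1 mem_setE in_itv/=.
  by case: ifPn.
Qed.

Lemma measurable_inv_sqr_add d (T : measurableType d) (f g : T -> R) :
  measurable_fun setT f -> measurable_fun setT g ->
  measurable_fun setT (fun x => (f x ^+ 2 + g x ^+ 2)^-1).
Proof.
move=> mf mg.
rewrite (_ : (fun x => _) = fun x => (f x ^+ 2 + g x ^+ 2) `^ (-1)); last first.
  by apply/funext => x; rewrite powR_inv1// addr_ge0// sqr_ge0.
apply: (measurableT_comp (measurable_powR _)).
by apply: measurable_funD; exact: measurable_funX.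
Qed.

Lemma measurable_re_inv d (T : measurableType d) (f g : T -> R) :
  measurable_fun setT f -> measurable_fun setT g ->
  measurable_fun setT (fun x => re_inv (f x) (g x)).
Proof.
move=> mf mg; apply: measurable_funM => //.
by apply: measurable_inv_sqr_add.
Qed.

Lemma measurable_im_inv d (T : measurableType d) (f g : T -> R) :
  measurable_fun setT f -> measurable_fun setT g ->
  measurable_fun setT (fun x => im_inv (f x) (g x)).
Proof.
move=> mf mg; apply: measurable_funM => //.
by apply: measurable_inv_sqr_add.
Qed.

Lemma re_inv_le (p q w : R) : 0 < w -> w <= q -> `|re_inv p q| <= w^-1.
Proof.
move=> w0 wq; have q0 : 0 < q by exact: lt_le_trans wq.
have N0 := sqr_add_gt0 p q0.
rewrite normrM normfV (gtr0_norm N0) ler_pdivrMr// mulrC ler_pdivlMr//.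
have pE : p ^+ 2 = `|p| ^+ 2 by rewrite real_normK// num_real.
have p0 := normr_ge0 p.
apply: (@le_trans _ _ (`|p| * q)); first by rewrite ler_wpM2l.
by rewrite pE; nra.
Qed.

Lemma im_inv_le (p q w : R) : 0 < w -> w <= q -> `|im_inv p q| <= w^-1.
Proof.
move=> w0 wq; have q0 : 0 < q by exact: lt_le_trans wq.
have N0 := sqr_add_gt0 p q0.
rewrite normrM normfV (gtr0_norm N0) ler_pdivrMr// mulrC ler_pdivlMr//.
by rewrite gtr0_norm//; nra.
Qed.

Lemma Rintegral_prodM (P Q : probability R R) (f g : R -> R) (M : R) :
  measurable_fun setT f -> measurable_fun setT g ->
  (forall x, `|f x| <= M) -> (forall x, `|g x| <= M) ->
  \int[(P \x Q)%E]_p (f p.1 * g p.2) = (\int[P]_x f x) * (\int[Q]_x g x).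
Proof.
move=> mf mg fM gM.
rewrite -(@Rintegral_prod12 _ _ _ _ _ P Q (fun p => f p.1 * g p.2) (M * M))//.
- rewrite -RintegralZr//; last exact: (bounded_integrable _ mf fM).
  apply: eq_Rintegral => x _; rewrite /= RintegralZl//.
  exact: (bounded_integrable _ mg gM).
- by apply: measurable_funM; exact: measurableT_comp.
- by move=> x; rewrite normrM ler_pM.
Qed.

Variable alpha : probability R R.

Hypothesis mix_inv : forall (phi : R -> R) (M : R), continuous phi ->
  (forall x, `|phi x| <= M) -> forall y, 0 <= y <= 1 ->
  \int[(alpha \x alpha)%E]_p phi (y * p.1 + (1 - y) * p.2) = \int[alpha]_x phi x.

(** Fubini brings the integral over y outside; the invariance is then applied at each fixed y to the
    test function K(y, .). *)
Lemma mix_inv_unif (K : R * R -> R) (M : R) : measurable_fun setT K ->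
  (forall x, `|K x| <= M) -> (forall y, continuous (fun x => K (y, x))) ->
  \int[(alpha \x alpha)%E]_p
    \int[mu]_(y in `[0, 1]) K (y, y * p.1 + (1 - y) * p.2) =
  \int[alpha]_x \int[mu]_(y in `[0, 1]) K (y, x).
Proof.
move=> mK KM cK.
have mKp (p : R) : measurable_fun setT (fun y : R => K (y, p)).
  exact: (measurableT_comp mK (@pair2_measurable _ _ _ _ p)).
have mmix : measurable_fun setT (fun q : R * (R * R) =>
    K (q.1, q.1 * q.2.1 + (1 - q.1) * q.2.2)).
  apply: (measurableT_comp mK); apply: measurable_fun_pair => //.
  have m1 : measurable_fun setT (fun q : R * (R * R) => q.2.1) by exact: measurableT_comp.
  have m2 : measurable_fun setT (fun q : R * (R * R) => q.2.2) by exact: measurableT_comp.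
  apply: measurable_funD; apply: measurable_funM => //.
  exact: measurable_funB.
transitivity (\int[(alpha \x alpha)%E]_p
    \int[unif01]_y K (y, y * p.1 + (1 - y) * p.2)).
  apply: eq_Rintegral => p _; rewrite (@Rintegral_unif01 _ M)//.
  exact: (measurableT_comp mmix (@pair2_measurable _ _ _ _ p)).
rewrite (@Rintegral_prod21 _ _ _ _ _ unif01 (alpha \x alpha)%E
  (fun q => K (q.1, q.1 * q.2.1 + (1 - q.1) * q.2.2)) M)//.
rewrite -(@Rintegral_prod12 _ _ _ _ _ unif01 (alpha \x alpha)%E
  (fun q => K (q.1, q.1 * q.2.1 + (1 - q.1) * q.2.2)) M)//.
transitivity (\int[unif01]_y \int[alpha]_x K (y, x)); last first.
  rewrite (@Rintegral_prod12 _ _ _ _ _ unif01 alpha K M)//.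
  rewrite -(@Rintegral_prod21 _ _ _ _ _ unif01 alpha K M)//.
  by apply: eq_Rintegral => x _; rewrite (@Rintegral_unif01 _ M).
rewrite !(@Rintegral_unif01 _ M).
- apply: eq_Rintegral => y; rewrite inE/= in_itv/= => y01.
  exact: (@mix_inv (fun x => K (y, x)) M).
- exact: (@measurable_Rintegral_fst _ _ _ _ _ unif01 alpha K M).
- move=> y; apply: Rintegral_bounded => //.
  exact: (measurableT_comp mK (@pair1_measurable _ _ _ _ y)).
- exact: (@measurable_Rintegral_fst _ _ _ _ _ unif01 (alpha \x alpha)%E
    (fun q => K (q.1, q.1 * q.2.1 + (1 - q.1) * q.2.2)) M).
- move=> y; apply: Rintegral_bounded => //.
  exact: (measurableT_comp mmix (@pair1_measurable _ _ _ _ y)).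
Qed.

(* For B of law alpha, E 1 / (u + i v - B) = cauchy_re u v - i cauchy_im u v. *)
Definition cauchy_re (u v : R) := \int[alpha]_x re_inv (u - x) v.
Definition cauchy_im (u v : R) := \int[alpha]_x im_inv (u - x) v.


Let mre u v : measurable_fun setT (fun x : R => re_inv (u - x) v).
Proof. by apply: measurable_re_inv => //; exact: measurable_funB. Qed.

Let mim u v : measurable_fun setT (fun x : R => im_inv (u - x) v).
Proof. by apply: measurable_im_inv => //; exact: measurable_funB. Qed.

Lemma cauchy_prod u v u' v' : 0 < v -> 0 < v' ->
  cauchy_re u v * cauchy_re u' v' - cauchy_im u v * cauchy_im u' v' =
    \int[alpha]_x (re_inv (u - x) v * re_inv (u' - x) v' -
                   im_inv (u - x) v * im_inv (u' - x) v') /\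
  cauchy_re u v * cauchy_im u' v' + cauchy_im u v * cauchy_re u' v' =
    \int[alpha]_x (re_inv (u - x) v * im_inv (u' - x) v' +
                   im_inv (u - x) v * re_inv (u' - x) v').
Proof.
move=> v0 v'0.
pose w := Num.min v v'.
have w0 : 0 < w by rewrite lt_min v0.
have wv : w <= v by rewrite ge_min lexx.
have wv' : w <= v' by rewrite ge_min lexx orbT.
(* The point uy + i vy follows the segment from u' + i v' at y = 0 to u + i v at y = 1. The maximum
   with [w] changes nothing on [0, 1], but keeps the kernels bounded for every real y. *)
pose uy y := u' + y * (u - u').
pose vy y := Num.max w (v' + y * (v - v')).
have wvy y : w <= vy y by rewrite le_max lexx.
have vyE y : y \in `[0, 1]%classic -> vy y = v' + y * (v - v').
  rewrite inE/= in_itv/= => /andP[y0 y1]; apply/max_idPr.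
  rewrite (_ : _ + _ = (1 - y) * v' + y * v); last by ring.
  have : 0 <= (1 - y) * (v' - w) + y * (v - w).
    by rewrite addr_ge0// mulr_ge0// subr_ge0.
  lra.
pose K1 (q : R * R) := re_inv (uy q.1 - q.2) (vy q.1) ^+ 2 -
  im_inv (uy q.1 - q.2) (vy q.1) ^+ 2.
pose K2 (q : R * R) := 2 * re_inv (uy q.1 - q.2) (vy q.1) *
  im_inv (uy q.1 - q.2) (vy q.1).
have muy : measurable_fun setT (fun q : R * R => uy q.1 - q.2).
  apply: measurable_funB => //; apply: measurable_funD => //.
  exact: measurable_funM.
have mvy : measurable_fun setT (fun q : R * R => vy q.1).
  apply: measurable_maxr => //; apply: measurable_funD => //.
  exact: measurable_funM.
have mK1 : measurable_fun setT K1.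
  by apply: measurable_funB; apply: measurable_funX;
    [exact: measurable_re_inv|exact: measurable_im_inv].
have mK2 : measurable_fun setT K2.
  apply: measurable_funM; last exact: measurable_im_inv.
  by apply: measurable_funM => //; exact: measurable_re_inv.
have K1M q : `|K1 q| <= w^-1 ^+ 2 + w^-1 ^+ 2.
  rewrite (le_trans (ler_normB _ _))// !normrX.
  rewrite lerD// lerXn2r// ?nnegrE ?invr_ge0 ?(ltW w0)//.
    exact: re_inv_le.
  exact: im_inv_le.
have K2M q : `|K2 q| <= 2 * w^-1 * w^-1.
  rewrite normrM [X in X * _]normrM; apply: ler_pM.
  - exact: mulr_ge0.
  - exact: normr_ge0.
  - by rewrite ger0_norm// ler_wpM2l//; exact: re_inv_le.
  - exact: im_inv_le.
have cu y : continuous (fun x => uy y - x).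
  by move=> x; apply: cvgB; [exact: cvg_cst|exact: cvg_id].
have vy0 y : 0 < vy y by exact: lt_le_trans (wvy y).
have cre y : continuous (fun x => re_inv (uy y - x) (vy y)).
  move=> x; apply: (@continuous_re_inv _ (fun x => uy y - x) (fun=> vy y)) => //.
    exact: cu.
  exact: cvg_cst.
have cim y : continuous (fun x => im_inv (uy y - x) (vy y)).
  move=> x; apply: (@continuous_im_inv _ (fun x => uy y - x) (fun=> vy y)) => //.
    exact: cu.
  exact: cvg_cst.
have cK1 y : continuous (fun x => K1 (y, x)).
  move=> x; apply: cvgB; rewrite expr2; apply: cvgM.
  - exact: cre.
  - exact: cre.
  - exact: cim.
  - exact: cim.
have cK2 y : continuous (fun x => K2 (y, x)).
  move=> x; apply: cvgM; last exact: cim.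
  by apply: cvgM; [exact: cvg_cst|exact: cre].
have F1 x x' : \int[mu]_(y in `[0, 1]) K1 (y, y * x + (1 - y) * x') =
    re_inv (u - x) v * re_inv (u' - x') v' - im_inv (u - x) v * im_inv (u' - x') v'.
  have [FE _] := Feynman_segment (u' - x') (u - x) v'0 v0.
  rewrite mulrC [im_inv _ _ * _]mulrC -FE.
  apply: eq_Rintegral => y y01; rewrite /K1/= vyE// /uy.
  rewrite (_ : u' + y * (u - u') - (y * x + (1 - y) * x') =
    u' - x' + y * (u - x - (u' - x')))//.
  by ring.
have F2 x x' : \int[mu]_(y in `[0, 1]) K2 (y, y * x + (1 - y) * x') =
    re_inv (u - x) v * im_inv (u' - x') v' + im_inv (u - x) v * re_inv (u' - x') v'.
  have [_ FE] := Feynman_segment (u' - x') (u - x) v'0 v0.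
  rewrite addrC mulrC [X in _ + X]mulrC -FE.
  apply: eq_Rintegral => y y01; rewrite /K2/= vyE// /uy.
  rewrite (_ : u' + y * (u - u') - (y * x + (1 - y) * x') =
    u' - x' + y * (u - x - (u' - x')))//.
  by ring.
have diag (y x : R) : y * x + (1 - y) * x = x by ring.
have re_le a b x : w <= b -> `|re_inv (a - x) b| <= w^-1 by exact: re_inv_le.
have im_le a b x : w <= b -> `|im_inv (a - x) b| <= w^-1 by exact: im_inv_le.
have int_prod (f g : R -> R) : measurable_fun setT f -> measurable_fun setT g ->
    (forall x, `|f x| <= w^-1) -> (forall x, `|g x| <= w^-1) ->
    (alpha \x alpha)%E.-integrable setT (EFin \o (fun p => f p.1 * g p.2)).
  move=> mf mg fw gw.
  apply: (@bounded_integrable _ _ _ (alpha \x alpha)%E _ (w^-1 * w^-1)).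
    by apply: measurable_funM; exact: measurableT_comp.
  by move=> x; rewrite normrM ler_pM.
have prod (f g : R -> R) : measurable_fun setT f -> measurable_fun setT g ->
    (forall x, `|f x| <= w^-1) -> (forall x, `|g x| <= w^-1) ->
    (\int[alpha]_x f x) * (\int[alpha]_x g x) =
    \int[(alpha \x alpha)%E]_p (f p.1 * g p.2).
  by move=> mf mg fw gw; rewrite (Rintegral_prodM _ _ mf mg fw gw).
have r x := re_le u v x wv; have r' x := re_le u' v' x wv'.
have i x := im_le u v x wv; have i' x := im_le u' v' x wv'.
have prod_rr := prod _ _ (mre u v) (mre u' v') r r'.
have prod_ii := prod _ _ (mim u v) (mim u' v') i i'.
have prod_ri := prod _ _ (mre u v) (mim u' v') r i'.
have prod_ir := prod _ _ (mim u v) (mre u' v') i r'.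
have int_rr := int_prod _ _ (mre u v) (mre u' v') r r'.
have int_ii := int_prod _ _ (mim u v) (mim u' v') i i'.
have int_ri := int_prod _ _ (mre u v) (mim u' v') r i'.
have int_ir := int_prod _ _ (mim u v) (mre u' v') i r'.
split.
- rewrite /cauchy_re /cauchy_im prod_rr prod_ii.
  rewrite -(RintegralB _ int_rr int_ii)//.
  transitivity (\int[(alpha \x alpha)%E]_p
    \int[mu]_(y in `[0, 1]) K1 (y, y * p.1 + (1 - y) * p.2)).
    by apply: eq_Rintegral => p _; rewrite F1.
  rewrite (mix_inv_unif mK1 K1M cK1); apply: eq_Rintegral => x _.
  by rewrite -F1; apply: eq_Rintegral => y _; rewrite diag.
- rewrite /cauchy_re /cauchy_im prod_ri prod_ir.
  rewrite -(RintegralD _ int_ri int_ir)//.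
  transitivity (\int[(alpha \x alpha)%E]_p
    \int[mu]_(y in `[0, 1]) K2 (y, y * p.1 + (1 - y) * p.2)).
    by apply: eq_Rintegral => p _; rewrite F2.
  rewrite (mix_inv_unif mK2 K2M cK2); apply: eq_Rintegral => x _.
  by rewrite -F2; apply: eq_Rintegral => y _; rewrite diag.
Qed.

End resolvent.

(** * The resolvent equation and its solutions *)

Section cauchy_transform.
Context {R : realType}.
Variable alpha : probability R R.
Hypothesis mix_inv : forall (phi : R -> R) (M : R), continuous phi ->
  (forall x, `|phi x| <= M) -> forall y, 0 <= y <= 1 ->
  \int[(alpha \x alpha)%E]_p phi (y * p.1 + (1 - y) * p.2) = \int[alpha]_x phi x.

Let mre u v : measurable_fun setT (fun x : R => re_inv (u - x) v).
Proof. by apply: measurable_re_inv => //; exact: measurable_funB. Qed.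

Let mim u v : measurable_fun setT (fun x : R => im_inv (u - x) v).
Proof. by apply: measurable_im_inv => //; exact: measurable_funB. Qed.

Let re_le u v (x : R) : 0 < v -> `|re_inv (u - x) v| <= v^-1.
Proof. by move=> v0; exact: re_inv_le. Qed.

Let im_le u v (x : R) : 0 < v -> `|im_inv (u - x) v| <= v^-1.
Proof. by move=> v0; exact: im_inv_le. Qed.

Let int_prod (f g : R -> R) (M M' : R) : measurable_fun setT f ->
  measurable_fun setT g -> (forall x, `|f x| <= M) -> (forall x, `|g x| <= M') ->
  alpha.-integrable setT (EFin \o (fun x => f x * g x)).
Proof.
move=> mf mg fM gM; apply: (@bounded_integrable _ _ _ alpha _ (M * M')).
  exact: measurable_funM.
by move=> x; rewrite normrM ler_pM.
Qed.

Lemma Rintegral_lin2 (f g h k : R -> R) (a b : R) :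
  alpha.-integrable setT (EFin \o f) -> alpha.-integrable setT (EFin \o g) ->
  alpha.-integrable setT (EFin \o h) -> alpha.-integrable setT (EFin \o k) ->
  (forall x, a * f x + b * g x = h x - k x) ->
  a * \int[alpha]_x f x + b * \int[alpha]_x g x =
  \int[alpha]_x h x - \int[alpha]_x k x.
Proof.
move=> intf intg inth intk fghk.
have intZ c (l : R -> R) : alpha.-integrable setT (EFin \o l) ->
    alpha.-integrable setT (EFin \o (fun x => c * l x)).
  by move=> intl; exact: (integrableZl measurableT c intl).
rewrite -!RintegralZl// -RintegralD//; try exact: intZ.
by rewrite -RintegralB//; apply: eq_Rintegral => x _; rewrite fghk.
Qed.

Let f1 := cauchy_re alpha.
Let f2 := cauchy_im alpha.

(* (z - w) f(z) f(w) = f(w) - f(z) *)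
Lemma resolvent u v u' v' : 0 < v -> 0 < v' ->
  (u - u') * (f1 u v * f1 u' v' - f2 u v * f2 u' v') +
  (v - v') * (f1 u v * f2 u' v' + f2 u v * f1 u' v') = f1 u' v' - f1 u v /\
  (u - u') * (f1 u v * f2 u' v' + f2 u v * f1 u' v') +
  (v' - v) * (f1 u v * f1 u' v' - f2 u v * f2 u' v') = f2 u' v' - f2 u v.
Proof.
move=> v0 v'0.
have [-> ->] := cauchy_prod mix_inv u u' v0 v'0.
have ire a b : 0 < b -> alpha.-integrable setT (EFin \o (fun x => re_inv (a - x) b)).
  by move=> b0; apply: (@bounded_integrable _ _ _ alpha _ b^-1) => // x; exact: re_le.
have iim a b : 0 < b -> alpha.-integrable setT (EFin \o (fun x => im_inv (a - x) b)).
  by move=> b0; apply: (@bounded_integrable _ _ _ alpha _ b^-1) => // x; exact: im_le.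
have r x := re_le u x v0; have r' x := re_le u' x v'0.
have i x := im_le u x v0; have i' x := im_le u' x v'0.
have irr := int_prod (mre u v) (mre u' v') r r'.
have iri := int_prod (mre u v) (mim u' v') r i'.
have iir := int_prod (mim u v) (mre u' v') i r'.
have iii := int_prod (mim u v) (mim u' v') i i'.
have iA : alpha.-integrable setT (EFin \o (fun x =>
    re_inv (u - x) v * re_inv (u' - x) v' - im_inv (u - x) v * im_inv (u' - x) v')).
  exact: (integrableB measurableT irr iii).
have iC : alpha.-integrable setT (EFin \o (fun x =>
    re_inv (u - x) v * im_inv (u' - x) v' + im_inv (u - x) v * re_inv (u' - x) v')).
  exact: (integrableD measurableT iri iir).
(* Partial fractions under the integral: (z - w) / ((z - x) (w - x)) = 1 / (w - x) - 1 / (z - x). *)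
split; apply: Rintegral_lin2 => //; try exact: ire; try exact: iim; move=> x.
  rewrite /re_inv /im_inv.
  have N0 := lt0r_neq0 (sqr_add_gt0 (u - x) v0).
  have N0' := lt0r_neq0 (sqr_add_gt0 (u' - x) v'0).
  by field; rewrite N0 N0'.
rewrite /re_inv /im_inv.
have N0 := lt0r_neq0 (sqr_add_gt0 (u - x) v0).
have N0' := lt0r_neq0 (sqr_add_gt0 (u' - x) v'0).
by field; rewrite N0 N0'.
Qed.

(** Ensures that f never vanishes, so that 1 / f makes sense. The integrand is positive everywhere,
    so a zero integral would make the whole space negligible. *)
Lemma cauchy_im_gt0 u v : 0 < v -> 0 < f2 u v.
Proof.
move=> v0.
have im_gt0 (x : R) : 0 < im_inv (u - x) v by rewrite divr_gt0// sqr_add_gt0.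
rewrite lt0r Rintegral_ge0 ?andbT; last by move=> x _; exact: ltW.
apply/eqP => f20.
have iim : alpha.-integrable setT (EFin \o (fun x => im_inv (u - x) v)).
  by apply: (@bounded_integrable _ _ _ alpha _ v^-1) => // x; exact: im_le.
have : ae_eq alpha setT (EFin \o (fun x => im_inv (u - x) v)) (cst 0%E).
  apply/ae_eq_integral_abs => //; first exact/measurable_EFinP.
  rewrite (eq_integral (EFin \o (fun x => im_inv (u - x) v))).
    by rewrite -EFin_Rintegral// -[X in X%:E]/(f2 u v) f20.
  by move=> x _ /=; rewrite gtr0_norm.
move=> [A [mA A0 subA]].
have : (alpha setT <= alpha A)%E.
  apply: le_measure; rewrite ?inE// => x _; apply: subA => /= /(_ I)[] /eqP.
  by rewrite gt_eqF.
by rewrite A0 [X in (X <= _)%E]probability_setT lee_fin ler10.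
Qed.

Lemma cauchy_im_formula : exists a b : R, 0 <= b /\
  forall u v, 0 < v -> f2 u v = (v + b) / ((u - a) ^+ 2 + (v + b) ^+ 2).
Proof.
pose n u v := f1 u v ^+ 2 + f2 u v ^+ 2.
have n0 u v : 0 < v -> 0 < n u v.
  by move=> v0; apply: sqr_add_gt0; exact: cauchy_im_gt0.
(* As f = f1 - i f2, these are the two parts of 1 / f = g1 + i g2. The constant 1 / f(z) - z,
   written -a + i b, is read off at z = i. *)
pose g1 u v := f1 u v / n u v.
pose g2 u v := f2 u v / n u v.
pose a := - g1 0 1.
pose b := g2 0 1 - 1.
have gE u v : 0 < v -> g1 u v = u - a /\ g2 u v = v + b.
  move=> v0; have [E1 E2] := resolvent u 0 v0 (@ltr01 R).
  have nn := lt0r_neq0 (n0 u v v0); have nn' := lt0r_neq0 (n0 0 1 (@ltr01 R)).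
  rewrite /g1 /g2 /a /b /g1 /g2 /n in nn nn' *; move: E1 E2 nn nn'.
  set x := f1 u v; set y := f2 u v; set x' := f1 0 1; set y' := f2 0 1.
  move=> E1 E2 nn nn'.
  (* [K1] and [K2] are the two parts of the resolvent equation multiplied by the conjugate of f(z)
     f(i), which clears the denominators of 1 / f(z) and 1 / f(i). *)
  have K1 : u * ((x ^+ 2 + y ^+ 2) * (x' ^+ 2 + y' ^+ 2)) =
      x * (x' ^+ 2 + y' ^+ 2) - x' * (x ^+ 2 + y ^+ 2).
    transitivity ((x * x' - y * y') * (x' - x) + (x * y' + y * x') * (y' - y)); last by ring.
    by rewrite -E1 -E2; ring.
  have K2 : (v - 1) * ((x ^+ 2 + y ^+ 2) * (x' ^+ 2 + y' ^+ 2)) =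
      y * (x' ^+ 2 + y' ^+ 2) - y' * (x ^+ 2 + y ^+ 2).
    transitivity ((x * y' + y * x') * (x' - x) - (x * x' - y * y') * (y' - y)); last by ring.
    by rewrite -E1 -E2; ring.
  split; apply/eqP; rewrite -subr_eq0.
  - rewrite (_ : _ - _ = (x * (x' ^+ 2 + y' ^+ 2) - x' * (x ^+ 2 + y ^+ 2) -
        u * ((x ^+ 2 + y ^+ 2) * (x' ^+ 2 + y' ^+ 2))) /
        ((x ^+ 2 + y ^+ 2) * (x' ^+ 2 + y' ^+ 2))); last by field; rewrite nn nn'.
    by rewrite K1 subrr mul0r.
  - rewrite (_ : _ - _ = (y * (x' ^+ 2 + y' ^+ 2) - y' * (x ^+ 2 + y ^+ 2) -
        (v - 1) * ((x ^+ 2 + y ^+ 2) * (x' ^+ 2 + y' ^+ 2))) /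
        ((x ^+ 2 + y ^+ 2) * (x' ^+ 2 + y' ^+ 2))); last by field; rewrite nn nn'.
    by rewrite K2 subrr mul0r.
exists a, b; split.
  rewrite leNgt; apply/negP => b0.
  (* At this height v + b = b / 2 would be negative, whereas [g2] is positive. *)
  have v0 : 0 < - b / 2 by rewrite divr_gt0// oppr_gt0.
  have [_ g2E] := gE 0 _ v0.
  have : 0 < g2 0 (- b / 2) by rewrite divr_gt0 ?n0 ?cauchy_im_gt0.
  by rewrite g2E; lra.
move=> u v v0; have [<- <-] := gE u v v0.
by have := n0 u v v0; rewrite /g1 /g2 /n => /lt0r_neq0 nn; field.
Qed.

End cauchy_transform.

(** * Stieltjes inversion *)

Section stieltjes.
Context {R : realType}.
Notation mu := (@lebesgue_measure R).

Lemma is_derive_atan_affine (p l v s : R) : 0 < v ->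
  is_derive s 1 (fun s : R => atan ((p + s * l) / v)) (l * im_inv (p + s * l) v).
Proof.
move=> v0.
have hf : is_derive s (1 : R) (fun s : R => (p + s * l) / v) (l / v).
  rewrite (_ : (fun s : R => _) = fun s => p / v + l / v * s + 0 * s ^+ 2).
    by apply: (is_derive_eq (is_derive_quadratic _ _ _ _)); ring.
  by apply/funext => z; ring.
apply: (is_derive_eq (is_derive1_comp (is_derive1_atan _) hf)).
have N0 := lt0r_neq0 (sqr_add_gt0 (p + s * l) v0).
rewrite /im_inv; field; rewrite N0 lt0r_neq0//=.
Qed.

Lemma Rintegral_im_inv (p l v x y : R) : 0 < v -> x < y ->
  \int[mu]_(s in `[x, y]) (l * im_inv (p + s * l) v) =
  atan ((p + y * l) / v) - atan ((p + x * l) / v).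
Proof.
move=> v0 xy; rewrite (FTC_segment xy (fun s _ => is_derive_atan_affine p l s v0))//.
move=> s _; apply: cvgM; first exact: cvg_cst.
apply: (@continuous_im_inv _ (fun s => p + s * l) (fun=> v)) => //; last exact: cvg_cst.
by apply: cvgD; [exact: cvg_cst|apply: cvgM; [exact: cvg_id|exact: cvg_cst]].
Qed.

Lemma cvg_atan_sg (c : R) : atan (c * n.+1%:R) @[n --> \oo] --> pi / 2 * Num.sg c.
Proof.
have pos (e : R) : 0 < e -> atan (e * n.+1%:R) @[n --> \oo] --> pi / 2.
  move=> e0.
  have h : e * n.+1%:R @[n --> \oo] --> +oo.
    have h1 : (n.+1%:R : R) @[n --> \oo] --> +oo.
      by rewrite (cvg_shiftS (fun n => n%:R : R)); exact: cvgr_idn.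
    apply/cvgryPge => A; move/cvgryPge : h1 => /(_ (A / e)).
    by apply: filterS => n; rewrite ler_pdivrMr// mulrC.
  exact: (cvg_comp _ _ h (@cvgy_atan R)).
have [c0|c0|->] := ltgtP c 0.
- rewrite ltr0_sg// mulrN1.
  rewrite (_ : (fun n => _) = fun n => - atan (- c * n.+1%:R)); last first.
    by apply/funext => n; rewrite mulNr atanN opprK.
  by apply: cvgN; apply: pos; rewrite oppr_gt0.
- by rewrite gtr0_sg// mulr1; exact: pos.
- rewrite sgr0 mulr0; under eq_fun do rewrite mul0r atan0.
  exact: cvg_cst.
Qed.

Variables (alpha : probability R R) (a b : R).
Hypothesis cauchy_imE : forall u v, 0 < v ->
  cauchy_im alpha u v = (v + b) / ((u - a) ^+ 2 + (v + b) ^+ 2).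

(** At z = a + i the formula gives mean 1 for 1 / ((a - x)^2 + 1), which is its maximum, attained
    only at x = a. *)
Lemma dirac_of_cauchy_im : b = 0 -> is_dirac alpha.
Proof.
move=> b0; exists a.
pose f (x : R) := 1 - im_inv (a - x) 1.
have im1 (x : R) : `|im_inv (a - x) 1| <= 1.
  by rewrite -[leRHS]invr1; exact: im_inv_le.
have mim : measurable_fun setT (fun x : R => im_inv (a - x) 1).
  by apply: measurable_im_inv => //; exact: measurable_funB.
have f_ge0 x : 0 <= f x.
  by rewrite subr_ge0 (le_trans (ler_norm _) (im1 x)).
have mf : measurable_fun setT f by exact: measurable_funB.
have intf : alpha.-integrable setT (EFin \o f).
  apply: (@bounded_integrable _ _ _ alpha _ (1 + 1)) => // x.
  by rewrite (le_trans (ler_normB _ _))// normr1 lerD2l.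
have f0 : \int[alpha]_x f x = 0.
  rewrite RintegralB//.
  - rewrite Rintegral_cst// [X in fine X]probability_setT/= mulr1.
    rewrite -[X in _ - X]/(cauchy_im alpha a 1) cauchy_imE//.
    by rewrite b0 addr0 subrr expr0n/= add0r expr1n divr1 subrr.
  - by apply: (@bounded_integrable _ _ _ alpha _ 1) => // x; rewrite normr1.
  - by apply: (@bounded_integrable _ _ _ alpha _ 1).
have : ae_eq alpha setT (EFin \o f) (cst 0%E).
  apply/ae_eq_integral_abs => //; first exact/measurable_EFinP.
  rewrite (eq_integral (EFin \o f)).
    by rewrite -EFin_Rintegral// f0.
  by move=> x _ /=; rewrite ger0_norm.
move=> [N [mN N0 subN]].
have Na : ~` [set a] `<=` N.
  move=> x xa; apply: subN => /= /(_ I)[] /eqP; apply/negP; rewrite gt_eqF//.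
  rewrite /f subr_gt0 /im_inv expr1n div1r invf_lt1; last by rewrite ltr_wpDl ?sqr_ge0.
  rewrite ltrDr exprn_even_gt0//= subr_eq0 eq_sym.
  by apply/eqP.
move=> A mA; rewrite /= diracE.
have [aA|aA] := boolP (a \in A).
  have AC0 : alpha (~` A) = 0%E.
    apply: (subset_measure0 _ mN) => //; first exact: measurableC.
    apply: subset_trans Na; apply: subsetC => x ->; exact: set_mem.
  have := probability_setC alpha mA; rewrite AC0.
  have : alpha A \is a fin_num by rewrite fin_num_measure.
  case: (alpha A) => // r _; rewrite -EFinB => -[] /eqP.
  by rewrite eq_sym subr_eq0 => /eqP <-.
apply: (subset_measure0 _ mN) => //; apply: subset_trans Na => x Ax xa.
by move: aA; rewrite notin_setE; apply; rewrite -xa.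
Qed.

Hypothesis b_gt0 : 0 < b.

(** The indicator of u is at most v [im_inv (u - x) v], whose mean is at most v / (v + b). Atoms
    have to be excluded because [Num.sg 0 = 0] would count the endpoints of an interval with weight
    one half. *)
Lemma measure_set1_eq0 u : alpha [set u] = 0%E.
Proof.
apply/eqP; rewrite eq_le measure_ge0 andbT.
have afin : alpha [set u] \is a fin_num by rewrite fin_num_measure.
rewrite -(fineK afin) lee_fin; apply/ler_addgt0Pl => e e0; rewrite addr0.
(* This choice gives v / (v + b) <= e. *)
pose v := e * b.
have v0 : 0 < v by rewrite mulr_gt0.
have -> : fine (alpha [set u]) = \int[alpha]_x \1_[set u] x.
  by rewrite /Rintegral integral_indic// setIT.
have iim : alpha.-integrable setT (EFin \o (fun x => im_inv (u - x) v)).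
  apply: (@bounded_integrable _ _ _ alpha _ v^-1).
    by apply: measurable_im_inv => //; exact: measurable_funB.
  by move=> x; exact: im_inv_le.
apply: (@le_trans _ _ (\int[alpha]_x (v * im_inv (u - x) v))).
  apply: le_Rintegral => //.
  - apply: (@bounded_integrable _ _ _ alpha _ 1) => // x.
    by rewrite indicE; case: (_ \in _); rewrite ?normr1 ?normr0.
  - exact: (integrableZl measurableT v iim).
  - move=> x _; rewrite indicE; case: (boolP (x \in _)); rewrite /im_inv => xu.
      move: xu; rewrite inE => ->.
      by rewrite subrr expr0n add0r/= mulrA -expr2 divff// sqrf_eq0 gt_eqF.
    by rewrite mulr_ge0 ?(ltW v0)// divr_ge0 ?(ltW v0)// ltW// sqr_add_gt0.
rewrite RintegralZl// -[X in _ * X]/(cauchy_im alpha u v) cauchy_imE//.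
have vb0 : 0 < v + b by rewrite addr_gt0.
have N0 := sqr_add_gt0 (u - a) vb0.
rewrite mulrA ler_pdivrMr//.
apply: (@le_trans _ _ (e * (v + b) ^+ 2)); last first.
  by rewrite ler_pM2l// lerDr sqr_ge0.
by rewrite /v expr2 mulrA ler_pM2r// ler_pM2l// lerDr ltW.
Qed.

(** Both sides compute the integral of [cauchy_im alpha u v] over u in [x, y], on the left by Fubini
    and on the right by [cauchy_imE]. The interval is parametrized by [0, 1] to integrate against
    [unif01]. *)
Lemma Rintegral_atan_diff x y v : 0 < v -> x < y ->
  \int[alpha]_t (atan ((y - t) / v) - atan ((x - t) / v)) =
  atan ((y - a) / (v + b)) - atan ((x - a) / (v + b)).
Proof.
move=> v0 xy; pose l := y - x.
have vb0 : 0 < v + b by rewrite addr_gt0.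
have segE c w : 0 < w -> \int[mu]_(s in `[0, 1]) (l * im_inv (x - c + s * l) w) =
    atan ((y - c) / w) - atan ((x - c) / w).
  move=> w0; rewrite Rintegral_im_inv// ?ltr01// mul0r addr0 mul1r.
  by congr (atan (_ / _) - _); rewrite /l; ring.
rewrite -segE//.
pose K (q : R * R) := l * im_inv (x - q.2 + q.1 * l) v.
have mK : measurable_fun setT K.
  apply: measurable_funM => //; apply: measurable_im_inv => //.
  by apply: measurable_funD; [exact: measurable_funB|exact: measurable_funM].
have KM q : `|K q| <= `|l| * v^-1.
  by rewrite /K normrM ler_wpM2l//; exact: im_inv_le.
transitivity (\int[alpha]_t \int[unif01]_s K (s, t)).
  apply: eq_Rintegral => t _; rewrite -segE// (@Rintegral_unif01 _ _ (`|l| * v^-1))//.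
  exact: (measurableT_comp mK (@pair2_measurable _ _ _ _ t)).
rewrite (@Rintegral_prod21 _ _ _ _ _ unif01 alpha K (`|l| * v^-1))//.
rewrite -(@Rintegral_prod12 _ _ _ _ _ unif01 alpha K (`|l| * v^-1))//.
rewrite (@Rintegral_unif01 _ _ (`|l| * v^-1)).
- apply: eq_Rintegral => s _; rewrite /K/= RintegralZl//.
    congr (_ * _); rewrite -[RHS](_ : cauchy_im alpha (x + s * l) v = _).
      by apply: eq_Rintegral => t _; congr im_inv; ring.
    by rewrite cauchy_imE// /im_inv; congr (_ / (_ ^+ 2 + _)); ring.
  apply: (@bounded_integrable _ _ _ alpha _ v^-1).
    apply: measurable_im_inv => //.
    by apply: measurable_funD => //; exact: measurable_funB.
  by move=> t; exact: im_inv_le.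
- exact: (@measurable_Rintegral_fst _ _ _ _ _ unif01 alpha K (`|l| * v^-1)).
- move=> s; apply: Rintegral_bounded => //.
  exact: (measurableT_comp mK (@pair1_measurable _ _ _ _ s)).
Qed.

Lemma measurable_sg : measurable_fun setT (@Num.sg R).
Proof.
rewrite (_ : @Num.sg R = fun x => \1_`]0, +oo[ x - \1_`]-oo, 0[ x).
  by apply: measurable_funB; apply: measurable_indic; exact: measurable_itv.
apply/funext => x; rewrite !indicE !mem_setE !in_itv/= andbT.
by case: sgrP => x0; rewrite ?ltxx ?x0 ?(lt_gtF x0) ?subr0 ?sub0r.
Qed.

(** The limit of [Rintegral_atan_diff] as v tends to 0. Its integrand on the left is pi times the
    indicator of ]x, y[, plus pi / 2 at each endpoint. *)
Lemma Rintegral_sg_diff x y : x < y ->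
  \int[alpha]_t (pi / 2 * Num.sg (y - t) - pi / 2 * Num.sg (x - t)) =
  atan ((y - a) / b) - atan ((x - a) / b).
Proof.
move=> xy.
pose v (n : nat) : R := n.+1%:R^-1.
have v0 n : 0 < v n by rewrite invr_gt0.
have matan c w : measurable_fun setT (fun t : R => atan ((c - t) / w)).
  apply: (measurableT_comp (continuous_measurable_fun (@continuous_atan R))).
  by apply: measurable_funM => //; exact: measurable_funB.
have msg c : measurable_fun setT (fun t : R => pi / 2 * Num.sg (c - t)).
  apply: measurable_funM => //; apply: (measurableT_comp measurable_sg).
  exact: measurable_funB.
have cvg1 : \int[alpha]_t (atan ((y - t) / v n) - atan ((x - t) / v n)) @[n --> \oo] -->
    \int[alpha]_t (pi / 2 * Num.sg (y - t) - pi / 2 * Num.sg (x - t)).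
  apply: (@Rintegral_cvg_bounded _ _ _ alpha _ _ (pi / 2 + pi / 2)).
  - by move=> n; exact: measurable_funB.
  - exact: measurable_funB.
  - apply: aeW => t; rewrite /v.
    under eq_fun do rewrite invrK.
    by apply: cvgB; exact: cvg_atan_sg.
  - move=> n t; rewrite (le_trans (ler_normB _ _))//.
    by rewrite lerD// ler_norml !ltW ?atan_gtNpi2 ?atan_ltpi2.
have cvg2 c : atan ((c - a) / (v n + b)) @[n --> \oo] --> atan ((c - a) / b).
  have h : (c - a) / (v n + b) @[n --> \oo] --> (c - a) / b.
    apply: cvgM; first exact: cvg_cst.
    apply: cvgV; first by rewrite gt_eqF.
    by rewrite -[X in _ --> X]add0r; apply: cvgD; [exact: cvg_harmonic|exact: cvg_cst].
  exact: (cvg_comp _ _ h (@continuous_atan R _)).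
move: cvg1; rewrite (_ : (fun n => _) =
    fun n => atan ((y - a) / (v n + b)) - atan ((x - a) / (v n + b))).
  by move=> cvg1; exact: (cvg_unique _ cvg1 (cvgB (cvg2 y) (cvg2 x))).
by apply/funext => n; exact: Rintegral_atan_diff.
Qed.

End stieltjes.

(** * Recovery of the Cauchy density *)

Section inversion.
Context {R : realType}.
Notation mu := (@lebesgue_measure R).
Variables (alpha : probability R R) (a b : R).
Hypothesis cauchy_imE : forall u v, 0 < v ->
  cauchy_im alpha u v = (v + b) / ((u - a) ^+ 2 + (v + b) ^+ 2).
Hypothesis b_gt0 : 0 < b.

Lemma continuous_cauchy_pdf : continuous (cauchy_pdf a b).
Proof.
move=> x; apply: cvgM; first exact: cvg_cst.
apply: (@continuous_im_inv _ (fun x => x - a) (fun=> b)) => //.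
  by apply: cvgB; [exact: cvg_id|exact: cvg_cst].
exact: cvg_cst.
Qed.

Lemma cauchy_pdf_ge0 x : 0 <= cauchy_pdf a b x.
Proof.
rewrite mulr_ge0 ?invr_ge0 ?pi_ge0// divr_ge0 ?(ltW b_gt0)//.
by rewrite ltW// sqr_add_gt0.
Qed.

Lemma measure_itv_cauchy (x y : R) : x < y ->
  alpha `]x, y]%classic = (\int[mu]_(u in `]x, y]) (cauchy_pdf a b u)%:E)%E.
Proof.
move=> xy.
have pi0 : 0 < pi :> R := pi_gt0 R.
have mpdf : measurable_fun setT (cauchy_pdf a b).
  exact: continuous_measurable_fun continuous_cauchy_pdf.
rewrite integral_itv_obnd_cbnd; last exact/measurable_EFinP/measurable_funTS.
rewrite -EFin_Rintegral//; last first.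
  exact: continuous_integrable_itv continuous_cauchy_pdf.
have -> : \int[mu]_(u in `[x, y]) cauchy_pdf a b u =
    pi^-1 * (atan ((y - a) / b) - atan ((x - a) / b)).
  transitivity (\int[mu]_(u in `[x, y]) (pi^-1 * (1 * im_inv (- a + u * 1) b))).
    by apply: eq_Rintegral => u _; rewrite /cauchy_pdf /im_inv mul1r mulr1 (addrC (- a)).
  rewrite RintegralZl//; first by rewrite Rintegral_im_inv// !mulr1 !(addrC (- a)).
  apply: continuous_integrable_itv => u; apply: cvgM; first exact: cvg_cst.
  apply: (@continuous_im_inv _ (fun u => - a + u * 1) (fun=> b)) => //.
    by apply: cvgD; [exact: cvg_cst|apply: cvgM; [exact: cvg_id|exact: cvg_cst]].
  exact: cvg_cst.
rewrite -(Rintegral_sg_diff cauchy_imE b_gt0 xy).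
have afin : alpha `]x, y]%classic \is a fin_num by rewrite fin_num_measure.
rewrite -(fineK afin); congr EFin.
have msg c : measurable_fun setT (fun t : R => pi / 2 * Num.sg (c - t)).
  apply: measurable_funM => //; apply: (measurableT_comp measurable_sg).
  exact: measurable_funB.
(* The two integrands can differ only at x and y, which carry no mass. *)
have -> : \int[alpha]_t (pi / 2 * Num.sg (y - t) - pi / 2 * Num.sg (x - t)) =
    \int[alpha]_t (pi * \1_`]x, y] t).
  congr fine; apply: ae_eq_integral => //.
  - by apply/measurable_EFinP; exact: measurable_funB.
  - by apply/measurable_EFinP; exact: measurable_funM.
  - exists ([set x] `|` [set y]); split.
    + exact: measurableU.
    + by apply: null_set_setU => //; exact: (measure_set1_eq0 cauchy_imE b_gt0).
    + move=> t /= ht; apply: contrapT => /not_orP[/eqP tx /eqP ty]; apply: ht => _.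
      congr EFin; rewrite indicE mem_setE in_itv/=.
      have sgn (z : R) : z < t -> Num.sg (z - t) = -1 by move=> ?; rewrite ltr0_sg// subr_lt0.
      have sgp (z : R) : t < z -> Num.sg (z - t) = 1 by move=> ?; rewrite gtr0_sg// subr_gt0.
      have [xt|xt|xt] := ltgtP x t; last by rewrite xt eqxx in tx.
        have [yt|yt|yt] := ltgtP t y; last by rewrite yt eqxx in ty.
          by rewrite (sgn x)// (sgp y)//=; field.
        by rewrite (sgn x)// (sgn y)//=; ring.
      by rewrite (sgp x)// (sgp y) ?(lt_trans xt)//=; ring.
rewrite RintegralZl//; last first.
  apply: (@bounded_integrable _ _ _ alpha _ 1) => // t.
  by rewrite indicE; case: (_ \in _); rewrite ?normr1 ?normr0.
rewrite mulrA mulVf ?gt_eqF// mul1r.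
by rewrite /Rintegral integral_indic// setIT.
Qed.

Lemma cauchy_of_cauchy_im : is_cauchy alpha.
Proof.
exists a, b; split => // A mA.
have mpdf : measurable_fun setT (EFin \o cauchy_pdf a b : measurableTypeR R -> \bar R).
  apply: measurableT_comp => //.
  exact: continuous_measurable_fun continuous_cauchy_pdf.
pose c (A : set (measurableTypeR R)) := (\int[mu]_(x in A) (cauchy_pdf a b x)%:E)%E.
have pdf_ge0 x : (0 <= (cauchy_pdf a b x)%:E)%E by rewrite lee_fin cauchy_pdf_ge0.
have c0 : c set0 = 0%E by rewrite /c integral_set0.
have c_ge0 B : (0 <= c B)%E by apply: integral_ge0.
have c_add : semi_sigma_additive c.
  move=> F mF tF mUF; rewrite /c ge0_integral_bigcup//; last exact: measurable_funTS.
  by apply: is_cvg_ereal_nneg_natsum_cond => n _ _; exact: c_ge0.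
pose hc := isMeasure.Build _ _ _ c c0 c_ge0 c_add.
pose mc : {measure set (measurableTypeR R) -> \bar R} := HB.pack c hc.
have mcE (x y : R) : mc `]x, y]%classic = alpha `]x, y]%classic.
  have [xy|yx] := ltP x y; first by rewrite measure_itv_cauchy.
  by rewrite set_itv_ge ?measure0// bnd_simp -leNgt.
suff : mc A = distribution alpha (@to_measurableTypeR R) A by move/esym.
have gen : (measurable : set (set (measurableTypeR R))) = <<s @ocitv R >>.
  by [].
have cov : \bigcup_k `](- k%:R), k%:R]%classic = [set: measurableTypeR R].
  exact: bigcup_itvT.
(* Half-open intervals form a generating pi-system, and the intervals ]-n, n] exhaust the line with
   finite mass. *)
have H := @measure_unique _ R (measurableTypeR R) (@ocitv R)
  (fun n : nat => `](- n%:R), n%:R]%classic) gen (@ocitvI R)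
  (fun i => @is_ocitv R _ _) cov mc
  (distribution alpha (@to_measurableTypeR R)) .
apply: H => //.
- by move=> _ [[x y] _ <-]; exact: mcE.
- move=> k; rewrite mcE.
  by rewrite -ge0_fin_numE// fin_num_measure.
Qed.

End inversion.

Theorem proposition6p3 (R : realType) (alpha : probability R R) (N : int)
    (FT1_alpha : FT1 alpha)
    (mu_alpha : forall n : int, N <= n -> 1 <= n ->
       is_mu (n%:~R : R) alpha alpha) :
  is_cauchy alpha \/ is_dirac alpha.
Proof.
have mix_inv (phi : R -> R) (M : R) : continuous phi ->
    (forall x, `|phi x| <= M) -> forall y, 0 <= y <= 1 ->
    \int[(alpha \x alpha)%E]_p phi (y * p.1 + (1 - y) * p.2) =
    \int[alpha]_x phi x.
  exact: mix_invariant mu_alpha.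
have [a [b [b_ge0 fE]]] := cauchy_im_formula mix_inv.
move: b_ge0; rewrite le_eqVlt => /predU1P[b0|b_gt0].
  by right; apply: (dirac_of_cauchy_im fE).
by left; exact: (cauchy_of_cauchy_im fE b_gt0).
Qed.
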